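(* Let $X$ be a metric space. Suppose that for every integer $n\geq 1$, no equivalence class of $E_X^{CC,\frac1n}$ contains a triod. Then $E_X^{CC}=E_X^A$.
   Context: A continuum is a nonempty compact connected metrizable space (single points are continua); an arc is a homeomorphic copy of $[0,1]$. A continuum $K$ is a triod if there is a subcontinuum $L\subset K$ such that $K\setminus L$ has at least three connected components. For a metric space $X$ and $\varepsilon>0$, $x\,E_X^{CC,\varepsilon}\,y$ iff there are $k\in\mathbb{N}$ and continua $K_0,\dots,K_k\subset X$ of diameter $<\varepsilon$ such that $x\in K_0$, $y\in K_k$ and $K_i\cap K_{i+1}\ne\emptyset$ for $0\le i<k$. The chain continuum-connection relation is $E_X^{CC}=\bigcap_{\varepsilon>0}E_X^{CC,\varepsilon}$. The arc-connection relation is $x\,E_X^A\,y$ iff $x=y$ or there is an arc in $X$ containing $x$ and $y$. *)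

(* Defs.v *)
From HB Require Import structures.
From mathcomp Require Export all_boot all_order all_algebra.
From mathcomp Require Export all_classical all_reals all_analysis.

Set Implicit Arguments.
Unset Strict Implicit.
Unset Printing Implicit Defensive.

Import Order.TTheory GRing.Theory Num.Theory.
Import numFieldNormedType.Exports.

Local Open Scope classical_set_scope.
Local Open Scope ring_scope.

Section Definitions.
Context {R : realType} {X : metricType R}.
Implicit Types (A K L : set X) (x y : X) (e : R).

(* [connected set0] holds in the library, hence the explicit nonemptiness. *)
Definition continuum K : Prop := [/\ K !=set0, compact K & connected K].

(* The extended-real supremum gives unbounded sets diameter +oo. *)
Definition diam A : \bar R :=
  ereal_sup [set (mdist x y)%:E | x in A & y in A].

(* f and g are mutually inverse continuous maps between the subspaces [0, 1]
   and A; their values outside these sets are irrelevant. *)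
Definition arc A : Prop :=
  exists (f : R -> X) (g : X -> R),
    [/\ {within `[0, 1], continuous f} /\ {within A, continuous g},
        f @` `[0, 1] `<=` A /\ g @` A `<=` `[0, 1],
        {in `[0, 1], cancel f g}
      & {in A, cancel g f}].

Definition three_components A : Prop :=
  exists x y z, [/\ A x, A y & A z] /\
    [/\ connected_component A x <> connected_component A y,
        connected_component A x <> connected_component A z
      & connected_component A y <> connected_component A z].

Definition triod K : Prop :=
  continuum K /\
  exists L, [/\ continuum L, L `<=` K & three_components (K `\` L)].

(* Only the first k + 1 terms of the sequence K are constrained. *)
Definition ECCe e : set (X * X) := [set p |
  exists (k : nat) (K : nat -> set X),
    [/\ forall i, (i <= k)%N -> continuum (K i) /\ (diam (K i) < e%:E)%E,
        K 0%N p.1, K k p.2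
      & forall i, (i < k)%N -> K i `&` K i.+1 !=set0]].

Definition ECC : set (X * X) := \bigcap_(e in [set e : R | 0 < e]) ECCe e.

Definition EA : set (X * X) := [set p |
  p.1 = p.2 \/ exists A, [/\ arc A, A p.1 & A p.2]].

End Definitions.

Arguments ECCe {R} X e.
Arguments ECC {R} X.
Arguments EA {R} X.

(* Main.v *)
Require Import Defs.
From mathcomp Require Import zify ring lra.
Import Order.TTheory GRing.Theory Num.Theory.
Import numFieldNormedType.Exports.
Local Open Scope classical_set_scope.
Local Open Scope ring_scope.

(* Let x and y be distinct and ECC-related, and consider minimal chains of small
   continua from x to y; their unions lie in a set without triods.  A piece of a
   fine chain that touches a coarse chain C away from its ends is contained in C,
   since otherwise it would be the third leg of a triod whose other legs are the
   two ends of C.  Hence each fine chain covers the middle part of C or avoids it.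
   Three chains avoiding each other's middle parts would be the legs of a triod
   around x, so there is a family of arbitrarily fine chains in which every chain
   is covered by all much finer ones.  A fine chain cannot cross a link of C three
   times, so it runs along C monotonically up to a bounded error, and the middle
   parts converge to a continuum I ordered by the position in the fine chains.
   The points between two close points of I are close to both, so z is mapped
   continuously and injectively to the reals by summing weighted distances from a
   dense sequence to the initial segment of I ending at z; hence I is an arc. *)

Set Implicit Arguments.
Unset Strict Implicit.
Unset Printing Implicit Defensive.

Ltac nat_lia := repeat match goal with
  | H : context [@Order.le] |- _ => clear H
  | H : context [@Order.lt] |- _ => clear H
  end; lia.

Section Continua.
Context {R : realType} {X : metricType R}.
Implicit Types (A B C K L S E : set X).

Lemma continuum_closed A : continuum A -> closed A.
Proof. by case=> _ Ac _; apply: compact_closed => //; exact: metric_hausdorff. Qed.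

Lemma continuumU A B : continuum A -> continuum B -> A `&` B !=set0 ->
  continuum (A `|` B).
Proof.
move=> [[a Aa] cA kA] [_ cB kB] AB; split; first by exists a; left.
  exact: compactU.
exact: connectedU.
Qed.

Lemma connected_sub_closed S A B : connected S -> closed A -> closed B ->
  S `<=` A `|` B -> S `&` (A `&` B) = set0 -> S `&` A !=set0 -> S `<=` A.
Proof.
move=> kS cA cB SAB SAB0 SA0.
suff <- : S `&` A = S by move=> z [].
apply: kS => //; last by exists A.
exists (~` B); first exact: closed_openC.
apply/seteqP; split=> z [Sz Az]; split=> //.
- by move=> Bz; have : set0 z by rewrite -SAB0.
- by case: (SAB z Sz).
Qed.

Lemma triod_of_legs L A B C : continuum L ->
  continuum A -> continuum B -> continuum C ->
  A `&` L !=set0 -> B `&` L !=set0 -> C `&` L !=set0 ->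
  ~ A `<=` L -> ~ B `<=` L -> ~ C `<=` L ->
  A `&` B `<=` L -> A `&` C `<=` L -> B `&` C `<=` L ->
  triod (L `|` A `|` B `|` C).
Proof.
move=> kL kA kB kC AL BL CL /existsNP[a /not_implyP[Aa La]]
  /existsNP[b /not_implyP[Bb Lb]] /existsNP[c /not_implyP[Cc Lc]] AB AC BC.
have meetU (P Q T : set X) : Q `&` T !=set0 -> T `<=` P -> P `&` Q !=set0.
  by move=> [z [Qz Tz]] TP; exists z; split=> //; exact: TP.
split.
  apply: continuumU => //; last by apply: (meetU _ _ L) => // z; left; left.
  apply: continuumU => //; last by apply: (meetU _ _ L) => // z; left.
  by apply: continuumU => //; rewrite setIC.
exists L; split=> //; first by move=> z Lz; left; left; left.
set M := _ `\` L.
have key (P Q : set X) p q : closed P -> closed Q -> M `<=` P `|` Q ->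
    P `&` Q `<=` L -> M p -> M q -> P p -> Q q ->
    connected_component M p <> connected_component M q.
  move=> cP cQ MPQ PQL Mp Mq Pp Qq pq.
  have := connected_component_refl Mq; rewrite -pq => pCq.
  suff : connected_component M p `<=` P.
    by move=> /(_ q pCq) Pq; case: Mq => _; apply; apply: PQL.
  apply: (@connected_sub_closed _ _ Q) => //.
  - exact: component_connected.
  - by apply: subset_trans MPQ; exact: connected_component_sub.
  - apply/seteqP; split=> // z [/connected_component_sub[_ Lz]] PQz.
    by case: Lz; exact: PQL.
  - by exists p; split=> //; exact: connected_component_refl.
have Ma : M a by split=> //; left; left; right.
have Mb : M b by split=> //; left; right.
have Mc : M c by split=> //; right.
have cA := continuum_closed kA; have cB := continuum_closed kB.
have cC := continuum_closed kC.
exists a, b, c; split=> //; split.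
- apply: (key A (B `|` C)) => //; [exact: closedU| | |by left].
  + by move=> z [[[[Lz|Az]|Bz]|Cz] nLz]; [|left|right; left|right; right].
  + by move=> z [Az [Bz|Cz]]; [apply: AB|apply: AC].
- apply: (key A (B `|` C)) => //; [exact: closedU| | |by right].
  + by move=> z [[[[Lz|Az]|Bz]|Cz] nLz]; [|left|right; left|right; right].
  + by move=> z [Az [Bz|Cz]]; [apply: AB|apply: AC].
- apply: (key B (A `|` C)) => //; [exact: closedU| | |by right].
  + by move=> z [[[[Lz|Az]|Bz]|Cz] nLz]; [|right; left|left|right; right].
  + by move=> z [Bz [Az|Cz]]; [apply: AB|apply: BC].
Qed.

Definition seg (K : nat -> set X) a b : set X :=
  \bigcup_(i in [set i | (a <= i <= b)%N]) K i.

Lemma seg_sub (K : nat -> set X) a b c d : (c <= a)%N -> (b <= d)%N ->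
  seg K a b `<=` seg K c d.
Proof. by move=> ca bd z [i /= ib Kz]; exists i => //=; lia. Qed.

Lemma mem_seg (K : nat -> set X) a b i z : (a <= i <= b)%N -> K i z ->
  seg K a b z.
Proof. by move=> ib Kz; exists i. Qed.

Lemma seg_continuum (K : nat -> set X) a b : (a <= b)%N ->
  (forall i, (a <= i <= b)%N -> continuum (K i)) ->
  (forall i, (a <= i < b)%N -> K i `&` K i.+1 !=set0) ->
  continuum (seg K a b).
Proof.
elim: b => [|b IH] ab kK mK.
  have -> : seg K a 0 = K 0%N; last by apply: kK; lia.
  apply/seteqP; split=> [z [i /= ib]|z K0]; last by exists 0%N => //=; lia.
  by have -> : i = 0%N by lia.
have [ba|{}ab] := leqP b.+1 a.
  have -> : seg K a b.+1 = K b.+1; last by apply: kK; lia.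
  apply/seteqP; split=> [z [i /= ib]|z K0]; last by exists b.+1 => //=; lia.
  by have -> : i = b.+1 by lia.
have -> : seg K a b.+1 = seg K a b `|` K b.+1.
  apply/seteqP; split=> [z [i /= ib Kz]|z [[i /= ib Kz]|Kz]].
  - have [ib'|ib'] := leqP i b; first by left; exists i => //=; lia.
    by right; have <- : i = b.+1 by lia.
  - by exists i => //=; lia.
  - by exists b.+1 => //=; lia.
apply: continuumU.
- by apply: IH => [|i ib|i ib]; [lia|apply: kK; lia|apply: mK; lia].
- by apply: kK; lia.
- have [|z [Kz K'z]] := mK b; first lia.
  by exists z; split=> //; exists b => //=; lia.
Qed.

Lemma diam_lt (A : set X) (e : R) a b : (diam A < e%:E)%E -> A a -> A b ->
  mdist a b < e.
Proof.
move=> Ae Aa Ab; rewrite -lte_fin; apply: le_lt_trans Ae.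
by apply: ereal_sup_ubound; exists a => //; exists b.
Qed.

Lemma diam_le (A : set X) (e : R) : (forall a b, A a -> A b -> mdist a b <= e) ->
  (diam A <= e%:E)%E.
Proof.
by move=> Ae; apply: ge_ereal_sup => _ [a Aa [b Ab <-]]; rewrite lee_fin; exact: Ae.
Qed.

(* A chain of minimal length: links meet only their neighbours, and only the
   extreme links contain the endpoints. *)
Record chain (Y : set X) (e : R) (x y : X) (k : nat) (K : nat -> set X) : Prop :=
  Chain {
  chain_continuum : forall i, (i <= k)%N -> continuum (K i) ;
  chain_diam : forall i, (i <= k)%N -> (diam (K i) < e%:E)%E ;
  chain_in : forall i, (i <= k)%N -> K i `<=` Y ;
  chain_meet : forall i, (i < k)%N -> K i `&` K i.+1 !=set0 ;
  chain_apart : forall i j a, (i.+1 < j)%N -> (j <= k)%N -> K i a -> K j a -> False ;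
  chain_left : K 0%N x ;
  chain_leftE : forall i, (i <= k)%N -> K i x -> i = 0%N ;
  chain_right : K k y ;
  chain_rightE : forall i, (i <= k)%N -> K i y -> i = k }.

End Continua.

Local Notation mid C k := (seg C 1 k.-1).

(** * Chains in a set without triods *)

Section Chains.
Context {R : realType} {X : metricType R} (Y : set X).
Implicit Types (A B C L S E : set X) (K : nat -> set X) (x y : X) (e : R).

Lemma seg_in K a b : (forall i, (i <= b)%N -> K i `<=` Y) -> seg K a b `<=` Y.
Proof. by move=> KY z [i /= ib]; apply: KY; lia. Qed.

Lemma chain_small e x y k K i a b : chain Y e x y k K -> (i <= k)%N ->
  K i a -> K i b -> mdist a b < e.
Proof. by move=> ch ik; apply: diam_lt; exact: (chain_diam ch). Qed.

Lemma chain_seg_continuum e x y k K a b : chain Y e x y k K ->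
  (a <= b)%N -> (b <= k)%N -> continuum (seg K a b).
Proof.
move=> ch ab bk; apply: seg_continuum => // i ib.
- by apply: (chain_continuum ch); lia.
- by apply: (chain_meet ch); lia.
Qed.

Lemma chain_seg_in e x y k K a b : chain Y e x y k K -> (b <= k)%N ->
  seg K a b `<=` Y.
Proof. by move=> ch bk; apply: seg_in => i ib; apply: (chain_in ch); lia. Qed.

Lemma chain_rev e x y k K : chain Y e x y k K ->
  chain Y e y x k (fun i => K (k - i)%N).
Proof.
case=> kK dK KY mK fK Kx Kx0 Ky Kyk.
split=> [i ik|i ik|i ik|i ik|i j a ij jk||i ik||i ik].
- by apply: kK; lia.
- by apply: dK; lia.
- by apply: KY; lia.
- have [|z] := mK (k - i.+1)%N; first lia.
  by rewrite (_ : (k - i.+1).+1 = (k - i)%N); [move=> [? ?]; exists z|lia].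
- by move=> Ki Kj; apply: (fK (k - j)%N (k - i)%N a _ _ Kj Ki); lia.
- by rewrite subn0.
- by move=> /Kyk; lia.
- by rewrite subnn.
- by move=> /Kx0; lia.
Qed.

Lemma chain_apartP e x y k K a b c d : chain Y e x y k K ->
  (b.+1 < c)%N -> (d <= k)%N -> seg K a b `&` seg K c d = set0.
Proof.
move=> ch bc dk; apply/seteqP; split=> // z [[i /= ib Ki] [j /= jb Kj]].
by apply: (chain_apart ch (i := i) (j := j) (a := z)) => //; lia.
Qed.

Lemma chain_hop e x y k K i j a b : chain Y e x y k K -> (i <= j)%N ->
  (j <= k)%N -> K i a -> K j b -> mdist a b < (j - i).+1%:R * e.
Proof.
move=> ch ij jk Ka; elim: j ij jk b => [|j IH] ij jk b Kb.
  have -> : (0 - i)%N = 0%N by lia.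
  by rewrite mul1r; apply: (chain_small ch (i := i)) => //; have -> : i = 0%N by lia.
move: ij; rewrite leq_eqVlt => /orP[/eqP ij|ij].
  rewrite -ij subnn mul1r; apply: (chain_small ch (i := i)) => //; first lia.
  by rewrite ij.
have [|z [Kz K'z]] := chain_meet ch (i := j); first lia.
rewrite (_ : (j.+1 - i)%N = (j - i).+1); last lia.
have az : mdist a z < (j - i).+1%:R * e by apply: IH => //; lia.
rewrite mulrSr mulrDl mul1r.
have := metric_triangle a z b.
by have := chain_small ch jk K'z Kb; lra.
Qed.

Hypothesis noT : forall T : set X, triod T -> ~ T `<=` Y.

Lemma no_legs L A B C : continuum L ->
  continuum A -> continuum B -> continuum C ->
  L `<=` Y -> A `<=` Y -> B `<=` Y -> C `<=` Y ->
  A `&` L !=set0 -> B `&` L !=set0 -> C `&` L !=set0 ->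
  ~ A `<=` L -> ~ B `<=` L -> ~ C `<=` L ->
  A `&` B `<=` L -> A `&` C `<=` L -> B `&` C `<=` L -> False.
Proof.
move=> kL kA kB kC LY AY BY CY AL BL CL nA nB nC AB AC BC.
apply: (noT (triod_of_legs kL kA kB kC AL BL CL nA nB nC AB AC BC)).
by move=> z [[[]|]|]; auto.
Qed.

Lemma no_three_strands e x y k K L a1 b1 a2 b2 a3 b3 : chain Y e x y k K ->
  continuum L -> L `<=` Y -> (a1 <= b1)%N -> (b1.+1 < a2)%N -> (a2 <= b2)%N ->
  (b2.+1 < a3)%N -> (a3 <= b3)%N -> (b3 <= k)%N ->
  seg K a1 b1 `&` L !=set0 -> seg K a2 b2 `&` L !=set0 -> seg K a3 b3 `&` L !=set0 ->
  ~ seg K a1 b1 `<=` L -> ~ seg K a2 b2 `<=` L -> ~ seg K a3 b3 `<=` L -> False.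
Proof.
move=> ch kL LY ab1 ba12 ab2 ba23 ab3 bk m1 m2 m3 n1 n2 n3.
apply: (@no_legs L (seg K a1 b1) (seg K a2 b2) (seg K a3 b3)) => //.
all: try by apply: (chain_seg_continuum ch); lia.
all: try by apply: (chain_seg_in ch); lia.
all: by rewrite (chain_apartP _ ch) //; lia.
Qed.

Lemma ex_first (P : nat -> Prop) n : P n ->
  exists m, [/\ (m <= n)%N, P m & forall i, (i < m)%N -> ~ P i].
Proof.
move=> Pn; have ex : exists n, (fun n => `[< P n >]) n by exists n; apply/asboolP.
case: (ex_minnP ex) => m /asboolP Pm mP; exists m; split=> //.
- by apply: mP; apply/asboolP.
- by move=> i im /asboolP/mP; lia.
Qed.

Lemma ex_last (P : nat -> Prop) n k : P n -> (n <= k)%N ->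
  exists m, [/\ (n <= m <= k)%N, P m & forall i, (m < i <= k)%N -> ~ P i].
Proof.
move=> Pn nk; have [|m [mn Pm mP]] := @ex_first (fun i => P (k - i)%N) (k - n)%N.
  by rewrite subKn.
exists (k - m)%N; split=> //; first lia.
move=> i ik Pi; apply: (mP (k - i)%N); first lia.
by rewrite subKn //; lia.
Qed.

Lemma no_escape e x y k K E : chain Y e x y k K -> continuum E -> E `<=` Y ->
  E `&` seg K 0 k !=set0 -> E `&` K 0%N = set0 -> E `&` K k = set0 ->
  E `<=` seg K 0 k.
Proof.
move=> ch kE EY [z [Ez [i /= ik Kz]]] E0 Ek.
pose touch i := (i <= k)%N /\ E `&` K i !=set0.
have ti : touch i by split=> //; exists z.
have [a [ai [ak ta] aP]] := ex_first ti.
have [b [/andP[ib _] [bk tb] bP]] := ex_last ti ik.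
have a0 : (0 < a)%N.
  by rewrite lt0n; apply/eqP => a0; move: ta; rewrite a0 E0 => -[].
have {}bk : (b < k)%N.
  by rewrite ltn_neqAle bk andbT; apply/eqP => b0; move: tb; rewrite b0 Ek => -[].
apply: contrapT => nE.
have seg0 c d : (forall i, (c <= i <= d)%N -> ~ touch i) ->
    (d <= k)%N -> seg K c d `&` E `<=` set0.
  move=> cd dk w [[j /= jb Kw] Ew]; apply: (cd j jb).
  by split; [lia|exists w].
apply: (@no_legs (seg K a b) (seg K 0 a.-1) (seg K b.+1 k) E) => //.
all: try by apply: (chain_seg_continuum ch); lia.
all: try by apply: (chain_seg_in ch); lia.
- have [|w [Kw K'w]] := chain_meet ch (i := a.-1); first lia.
  exists w; split; first by apply: mem_seg Kw; lia.
  by apply: mem_seg K'w; lia.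
- have [w [Kw K'w]] := chain_meet ch bk.
  exists w; split; first by apply: mem_seg K'w; lia.
  by apply: mem_seg Kw; lia.
- by exists z; split=> //; apply: mem_seg Kz; lia.
- move=> /(_ x)[|j /= jb /(chain_leftE ch)]; last lia.
  by apply: mem_seg (chain_left ch); lia.
- move=> /(_ y)[|j /= jb /(chain_rightE ch)]; last lia.
  by apply: mem_seg (chain_right ch); lia.
- by move=> Eab; apply: nE; apply: subset_trans Eab _; apply: seg_sub; lia.
- by rewrite (chain_apartP _ ch) //; lia.
- apply: subset_trans (@sub0set _ _); apply: seg0; last lia.
  by move=> j jb; apply: aP; lia.
- apply: subset_trans (@sub0set _ _); apply: seg0; last lia.
  by move=> j jb; apply: bP; lia.
Qed.

(* A chain that returns to [E] after leaving the neighbourhood of [y] meets the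
   continuum formed by [E], [K q] and [K k] with three disjoint strands. *)
Lemma chain_near_right d e x y k K E q b p : chain Y d x y k K ->
  2 * d <= e -> 2 * e <= mdist x y -> continuum E -> E `<=` Y -> E y ->
  (forall a b, E a -> E b -> mdist a b < e) ->
  (q <= b)%N -> (b <= k)%N -> K q `&` E !=set0 -> K b p -> mdist y p < 2 * e.
Proof.
move=> ch de exy kE EY Ey dE qb bk [z [Kz Ez]] Kp; rewrite ltNge; apply/negP => yp.
have tri := @metric_triangle _ X; have sm := chain_small ch.
have yz : mdist y z < e := dE y z Ey Ez.
have qk : (q <= k)%N := leq_trans qb bk.
have xx : mdist x x < d := sm 0%N _ _ (leq0n _) (chain_left ch) (chain_left ch).
rewrite mdistxx in xx.
have yKq w : K q w -> mdist y w < e + d.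
  by move=> Kw; have := tri y z w; have := sm q z w qk Kz Kw; lra.
pose L := E `|` K q `|` K k.
have yL w : L w -> mdist y w < e + d.
  move=> [[/(dE y w Ey)|/yKq]|/(sm k y w (leqnn _) (chain_right ch))]; lra.
have yx : mdist y x = mdist x y by exact: metric_sym.
have step i u v : (i < k)%N -> K i u -> K i.+1 v -> mdist u v < 2 * d.
  move=> ik Ku Kv; have [w [Kw K'w]] := chain_meet ch ik.
  have := sm i u w (ltnW ik) Ku Kw; have := sm _ w v ik K'w Kv.
  by have := tri u w v; lra.
have q0 : (0 < q)%N.
  rewrite lt0n; apply/eqP => q0; move: Kz; rewrite q0 => Kz.
  by have := yKq x; rewrite q0 => /(_ (chain_left ch)); lra.
have qb2 : (q.+2 <= b)%N.
  apply: contrapT => nqb.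
  have [bq|bq] : b = q \/ b = q.+1 by lia.
    by have := yKq p; rewrite -bq => /(_ Kp); lra.
  have := step q z p _ Kz; rewrite -bq => /(_ bk Kp) zp.
  by have := tri y z p; lra.
have bk2 : (b.+2 <= k)%N.
  apply: contrapT => nqb.
  have [kb|kb] : k = b \/ k = b.+1 by lia.
    by have := sm k y p (leqnn _) (chain_right ch); rewrite {1}kb => /(_ Kp); lra.
  have := step b p y; rewrite -kb => /(_ (leqnn _) Kp (chain_right ch)).
  by rewrite metric_sym; lra.
have far i w : (b.-1 <= i <= b.+1)%N -> K i w -> K b w -> ~ L w.
  move=> ib Kw K'w /yL; have := sm b p w bk Kp K'w; have := tri y w p.
  by rewrite (@metric_sym _ _ w p); lra.
have kL : continuum L.
  apply: continuumU; last by exists y; split; [left|exact: (chain_right ch)].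
    apply: continuumU => //; last by exists z.
    exact: (chain_continuum ch).
  exact: (chain_continuum ch).
apply: (@no_three_strands d x y k K L 0 q.-1 q.+1 b.-1 b.+1 k.-1) => //; try lia.
- by move=> w [[/EY|/(chain_in ch qk)]|/(chain_in ch (leqnn _))].
- have [|w [Kw K'w]] := chain_meet ch (i := q.-1); first lia.
  exists w; split; first by apply: mem_seg Kw; lia.
  by left; right; move: K'w; rewrite prednK.
- have [|w [Kw K'w]] := chain_meet ch (i := q); first lia.
  exists w; split; first by apply: mem_seg K'w; lia.
  by left; right.
- have [|w [Kw K'w]] := chain_meet ch (i := k.-1); first lia.
  exists w; split; first by apply: mem_seg Kw; lia.
  by right; move: K'w; rewrite prednK //; lia.
- move=> /(_ x) Lx; have {}Lx : L x by apply: Lx; apply: mem_seg (chain_left ch).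
  by have := yL x Lx; lra.
- have [|w [Kw K'w]] := chain_meet ch (i := b.-1); first lia.
  rewrite prednK in K'w; last lia.
  move=> /(_ w) Lw; apply: (far b.-1 w) => //; first lia.
  by apply: Lw; apply: mem_seg Kw; lia.
- have [|w [Kw K'w]] := chain_meet ch (i := b); first lia.
  move=> /(_ w) Lw; apply: (far b.+1 w) => //; first lia.
  by apply: Lw; apply: mem_seg K'w; lia.
Qed.

Lemma chain_near_left d e x y k K E q b p : chain Y d x y k K ->
  2 * d <= e -> 2 * e <= mdist x y -> continuum E -> E `<=` Y -> E x ->
  (forall a b, E a -> E b -> mdist a b < e) ->
  (b <= q)%N -> (q <= k)%N -> K q `&` E !=set0 -> K b p -> mdist x p < 2 * e.
Proof.
move=> ch de exy kE EY Ex dE bq qk qE Kp.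
apply: (chain_near_right (E := E) (q := (k - q)%N) (b := (k - b)%N) (chain_rev ch)) => //.
all: try lia.
- by rewrite metric_sym.
- by rewrite subKn.
- by rewrite subKn //; lia.
Qed.

Lemma chain_separates e x y k K S t : chain Y e x y k K -> connected S ->
  S `<=` seg K 0 k -> (0 < t < k)%N -> S `&` seg K 0 t.-1 !=set0 ->
  S `&` seg K t.+1 k !=set0 -> S `&` K t !=set0.
Proof.
move=> ch kS SK tk S0 [z [Sz Kz]]; apply: contrapT => /nonemptyPn nS.
suff /(_ z Sz) : S `<=` seg K 0 t.-1.
  move=> K'z; have : (seg K 0 t.-1 `&` seg K t.+1 k) z by [].
  by rewrite (chain_apartP _ ch) //; lia.
apply: (@connected_sub_closed _ _ _ _ (seg K t.+1 k)) => //.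
- by apply: continuum_closed; apply: (chain_seg_continuum ch); lia.
- by apply: continuum_closed; apply: (chain_seg_continuum ch); lia.
- move=> w Sw; have [i /= ik Kw] := SK w Sw.
  have [it|ti|it] := ltngtP i t.
  + by left; apply: mem_seg Kw; lia.
  + by right; apply: mem_seg Kw; lia.
  + by have : set0 w by rewrite -nS; split=> //; rewrite -it.
- by rewrite (chain_apartP _ ch) ?setI0 //; lia.
Qed.

End Chains.

Section Gaps.
Context {R : realType} {X : metricType R}.
Implicit Types (A B : set X) (K : nat -> set X) (x y : X) (e : R).

Lemma nbhs_mdist x (P : set X) :
  nbhs x P <-> exists2 r : R, 0 < r & forall z, mdist x z < r -> P z.
Proof.
split=> [/nbhs_ballP[r /= r0 rP]|[r r0 rP]].
  by exists r => // z xz; apply: rP; rewrite ballEmdist.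
by apply/nbhs_ballP; exists r => //= z; rewrite ballEmdist; exact: rP.
Qed.

Lemma pos_min (a b : R) : 0 < a -> 0 < b -> exists e, [/\ 0 < e, e <= a & e <= b].
Proof.
move=> a0 b0; exists (Num.min a b).
by rewrite lt_min a0 b0 !ge_min !lexx orbT.
Qed.

Lemma closed_gap B x : closed B -> ~ B x ->
  exists2 r : R, 0 < r & forall z, B z -> r <= mdist x z.
Proof.
move=> /closed_openC oB nBx.
have /nbhs_mdist[r r0 rB] : nbhs x (~` B) by exact: open_nbhs_nbhs.
by exists r => // z Bz; rewrite leNgt; apply/negP => /rB.
Qed.

Lemma compact_gap A B : compact A -> closed B -> A `&` B = set0 ->
  exists2 r : R, 0 < r & forall a b, A a -> B b -> r <= mdist a b.
Proof.
move=> cA cB AB.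
have : \forall r \near (0 : R)^'+, A `<=` [set a | forall b, B b -> r <= mdist a b].
  move/compact_near_coveringP : cA; apply => a Aa.
  have [|r r0 rB] := @closed_gap B a cB.
    by move=> Ba; have : set0 a by rewrite -AB.
  exists ([set a' | mdist a a' < r / 2], [set s : R | s <= r / 2]) => /=.
    split; last by apply: nbhs_right_ltW; rewrite divr_gt0.
    by apply/nbhs_mdist; exists (r / 2) => //; rewrite divr_gt0.
  move=> [a' s] /= [aa' sr] b Bb.
  by have := metric_triangle a a' b; have := rB b Bb; lra.
move=> rB; have : \forall r \near (0 : R)^'+,
    0 < r /\ A `<=` [set a | forall b, B b -> r <= mdist a b].
  by near=> r; split; near: r => //; exact: nbhs_right_gt.
by case/filter_ex => r [r0 {}rB]; exists r => // a b /rB; exact.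
Unshelve. all: by end_near. Qed.

Lemma uniform_gap (P : nat -> R -> Prop) k :
  (forall i r s, P i r -> s <= r -> P i s) ->
  (forall i, (i <= k)%N -> exists2 r : R, 0 < r & P i r) ->
  exists2 r : R, 0 < r & forall i, (i <= k)%N -> P i r.
Proof.
move=> dP; elim: k => [|k IH] exP.
  have [r r0 Pr] := exP 0%N isT; exists r => // i i0.
  by have -> : i = 0%N by lia.
have [|r r0 Pr] := IH; first by move=> i ik; apply: exP; lia.
have [s s0 Ps] := exP k.+1 (leqnn _).
exists (Num.min r s); first by rewrite lt_min r0.
move=> i; rewrite leq_eqVlt => /orP[/eqP ->|ik].
  by apply: dP Ps _; rewrite ge_min lexx orbT.
by apply: dP (Pr i _) _ => //; rewrite ge_min lexx.
Qed.

Definition chain_gap x y k K (g : R) := [/\ 0 < g,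
  forall i j a b, (i.+1 < j)%N -> (j <= k)%N -> K i a -> K j b -> g <= mdist a b,
  forall i a, (0 < i <= k)%N -> K i a -> g <= mdist x a &
  forall i a, (i < k)%N -> K i a -> g <= mdist y a].

Lemma chain_gap_ex (Y : set X) e x y k K : chain Y e x y k K ->
  exists g, chain_gap x y k K g.
Proof.
move=> ch.
pose P1 i (r : R) := forall j a b, (i.+1 < j)%N -> (j <= k)%N ->
  K i a -> K j b -> r <= mdist a b.
pose P2 i (r : R) := forall a, (0 < i)%N -> K i a -> r <= mdist x a.
pose P3 i (r : R) := forall a, (i < k)%N -> K i a -> r <= mdist y a.
have cl i : (i <= k)%N -> closed (K i).
  by move=> ik; apply: continuum_closed; exact: (chain_continuum ch).
have [||g1 g10 G1] := @uniform_gap P1 k.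
- move=> i r s Pr sr j a b ij jk Ka Kb.
  by apply: le_trans sr _; exact: Pr Ka Kb.
- move=> i ik; pose Q j (r : R) := forall a b, (i.+1 < j)%N ->
    K i a -> K j b -> r <= mdist a b.
  have [||r r0 rQ] := @uniform_gap Q k.
  + move=> j r s Qr sr a b ij Ka Kb.
    by apply: le_trans sr _; exact: Qr Ka Kb.
  + move=> j jk; have [ij|ij] := boolP (i.+1 < j)%N; last first.
      by exists 1 => // a b; rewrite (negbTE ij).
    have [| | |r r0 rK] := @compact_gap (K i) (K j).
    * by case: (chain_continuum ch ik).
    * exact: cl.
    * by apply/seteqP; split=> // z [Ki Kj]; exact: (chain_apart ch ij jk Ki Kj).
    by exists r => // a b _; exact: rK.
  by exists r => // j a b ij jk; exact: rQ.
have [||g2 g20 G2] := @uniform_gap P2 k.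
- by move=> i r s Pr sr a i0 Ka; apply: le_trans sr _; exact: Pr Ka.
- move=> i ik; have [i0|i0] := boolP (0 < i)%N; last first.
    by exists 1 => // a; rewrite (negbTE i0).
  have [|r r0 rK] := @closed_gap (K i) x (cl _ ik); last by exists r => // a _; exact: rK.
  by move=> /(chain_leftE ch ik) ei; rewrite ei in i0.
have [||g3 g30 G3] := @uniform_gap P3 k.
- by move=> i r s Pr sr a i0 Ka; apply: le_trans sr _; exact: Pr Ka.
- move=> i ik; have [i0|i0] := boolP (i < k)%N; last first.
    by exists 1 => // a; rewrite (negbTE i0).
  have [|r r0 rK] := @closed_gap (K i) y (cl _ ik); last by exists r => // a _; exact: rK.
  by move=> /(chain_rightE ch ik) ei; rewrite ei ltnn in i0.
exists (Num.min g1 (Num.min g2 g3)); split.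
- by rewrite !lt_min g10 g20.
- move=> i j a b ij jk Ka Kb; rewrite ge_min (G1 i _ j a b) //; lia.
- by move=> i a /andP[i0 ik] Ka; rewrite !ge_min (G2 i) ?orbT.
- by move=> i a ik Ka; rewrite !ge_min (G3 i) ?orbT //; lia.
Qed.

End Gaps.

(** * Refinement of chains *)

Section Refinement.
Context {R : realType} {X : metricType R} (Y : set X) (x y : X).
Hypothesis noT : forall T : set X, triod T -> ~ T `<=` Y.
Implicit Types (C D F : nat -> set X) (e d g : R).

Lemma chain_spread e k C n i j a b : chain Y e x y k C -> (i <= j)%N ->
  (j <= k)%N -> C i a -> C j b -> n%:R * e <= mdist a b -> (n <= j - i)%N.
Proof.
move=> ch ij jk Ca Cb /le_lt_trans/(_ (chain_hop ch ij jk Ca Cb)).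
have e0 : 0 < e.
  by have := chain_small ch (leq0n k) (chain_left ch) (chain_left ch); rewrite mdistxx.
by rewrite ltr_pM2r // ltr_nat; nat_lia.
Qed.

Lemma chain_length e k C n : chain Y e x y k C -> n%:R * e <= mdist x y ->
  (n <= k)%N.
Proof.
move=> ch /(chain_spread ch (leq0n k) (leqnn k) (chain_left ch) (chain_right ch)).
by rewrite subn0.
Qed.

Lemma mid_dichotomy e d g k C l D : chain Y e x y k C -> chain Y d x y l D ->
  chain_gap x y k C g -> d <= g -> 2 * e <= mdist x y ->
  mid C k `<=` seg D 0 l \/ mid C k `&` seg D 0 l = set0.
Proof.
move=> chC chD [_ _ gx gy] dg exy.
have k2 : (2 <= k)%N := chain_length chC exy.
have [ne|/nonemptyPn ->] := pselect (mid C k `&` seg D 0 l !=set0); last by right.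
left; apply: (no_escape noT chD) => //.
- by apply: (chain_seg_continuum chC); nat_lia.
- by apply: (chain_seg_in chC); nat_lia.
- apply/seteqP; split=> // z [[i /= ik Cz] Dz].
  have := chain_small chD (leq0n l) (chain_left chD) Dz.
  by have := gx i z _ Cz => /(_ ltac:(nat_lia)); lra.
- apply/seteqP; split=> // z [[i /= ik Cz] Dz].
  have := chain_small chD (leqnn l) (chain_right chD) Dz.
  by have := gy i z _ Cz => /(_ ltac:(nat_lia)); lra.
Qed.

Lemma no_three_mids e1 k1 C1 e2 k2 C2 e3 k3 C3 e :
  chain Y e1 x y k1 C1 -> chain Y e2 x y k2 C2 -> chain Y e3 x y k3 C3 ->
  e1 <= e -> e2 <= e -> e3 <= e -> 2 * e <= mdist x y ->
  mid C1 k1 `&` seg C2 0 k2 = set0 -> mid C1 k1 `&` seg C3 0 k3 = set0 ->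
  mid C2 k2 `&` seg C3 0 k3 = set0 -> False.
Proof.
move=> ch1 ch2 ch3 e1e e2e e3e exy d12 d13 d23.
pose L := C1 0%N `|` C2 0%N `|` C3 0%N.
have xL z : L z -> mdist x z < e.
  have s1 := chain_small ch1 (leq0n _) (chain_left ch1).
  have s2 := chain_small ch2 (leq0n _) (chain_left ch2).
  have s3 := chain_small ch3 (leq0n _) (chain_left ch3).
  by move=> [[/s1|/s2]|/s3]; lra.
have len e' k C : chain Y e' x y k C -> e' <= e -> (2 <= k)%N.
  move=> ch e'e; apply: (chain_length ch); lra.
have notL e' k C : chain Y e' x y k C -> e' <= e -> ~ mid C k `<=` L.
  move=> ch e'e; have kge2 := len _ _ _ ch e'e.
  have [|z [Cz C'z]] := chain_meet ch (i := k.-1); first nat_lia.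
  rewrite prednK in C'z; last nat_lia.
  move=> /(_ z) Lz; have {}Lz : L z by apply: Lz; apply: mem_seg Cz; nat_lia.
  have := xL z Lz; have := chain_small ch (leqnn k) (chain_right ch) C'z.
  by have := metric_triangle x z y; rewrite (metric_sym z y); lra.
have meetL e' k C : chain Y e' x y k C -> e' <= e -> C 0%N `<=` L ->
    mid C k `&` L !=set0.
  move=> ch e'e CL; have kge2 := len _ _ _ ch e'e.
  have [|z [Cz C'z]] := chain_meet ch (i := 0%N); first nat_lia.
  by exists z; split; [apply: mem_seg C'z; nat_lia|exact: CL].
have contM e' k C : chain Y e' x y k C -> e' <= e -> continuum (mid C k).
  by move=> ch /(len _ _ _ ch) kge2; apply: (chain_seg_continuum ch); nat_lia.
have inM e' k C : chain Y e' x y k C -> mid C k `<=` Y.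
  by move=> ch; apply: (chain_seg_in ch); nat_lia.
have sub0 (A B : set X) k C : A `&` seg C 0 k = set0 -> B `<=` seg C 0 k ->
    A `&` B `<=` L.
  by move=> dAC BC z [Az /BC Cz]; have : set0 z by rewrite -dAC.
apply: (no_legs noT (L := L) (A := mid C1 k1) (B := mid C2 k2) (C := mid C3 k3)).
- have Lx1 := chain_left ch1; have Lx2 := chain_left ch2; have Lx3 := chain_left ch3.
  apply: continuumU; last by exists x; split; [left|].
    apply: continuumU; last by exists x.
      exact: (chain_continuum ch1).
    exact: (chain_continuum ch2).
  exact: (chain_continuum ch3).
- exact: contM ch1 e1e.
- exact: contM ch2 e2e.
- exact: contM ch3 e3e.
- by move=> z [[]|]; [exact: (chain_in ch1)|exact: (chain_in ch2)|exact: (chain_in ch3)].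
- exact: inM ch1.
- exact: inM ch2.
- exact: inM ch3.
- by apply: meetL ch1 e1e _ => z; left; left.
- by apply: meetL ch2 e2e _ => z; left; right.
- by apply: meetL ch3 e3e _ => z; right.
- exact: notL ch1 e1e.
- exact: notL ch2 e2e.
- exact: notL ch3 e3e.
- by apply: sub0 d12 _; apply: seg_sub; nat_lia.
- by apply: sub0 d13 _; apply: seg_sub; nat_lia.
- by apply: sub0 d23 _; apply: seg_sub; nat_lia.
Qed.

(* The links of the finer chain [D] with index at most [s], resp. at least [t],
   stay near [x], resp. [y]; those in between run monotonically along [C], up to
   a bounded error. *)
Definition refines e k C l D s t := [/\ (s < t <= l)%N,
  forall j z, (j <= s)%N -> D j z -> mdist x z < 2 * e,
  forall j z, (t <= j <= l)%N -> D j z -> mdist y z < 2 * e,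
  forall j, (s < j < t)%N -> D j `<=` mid C k &
  forall a b i j u v, (s < a < t)%N -> (s < b < t)%N -> (i <= k)%N -> (j <= k)%N ->
    D a u -> C i u -> D b v -> C j v -> (i + 4 <= j)%N -> (a < b)%N].

Lemma mid_far_point e k C : chain Y e x y k C -> 10 * e <= mdist x y ->
  exists z, [/\ mid C k z, 2 * e <= mdist x z & 2 * e <= mdist y z].
Proof.
move=> ch exy.
have sm := chain_small ch; have tri := @metric_triangle _ X.
have e0 : 0 < e.
  by have := sm _ _ _ (leq0n k) (chain_left ch) (chain_left ch); rewrite mdistxx.
pose P i := (i <= k)%N /\ exists2 z, C i z & 3 * e <= mdist x z.
have [|i [_ [ik [z Cz xz]] iP]] := @ex_first P k.
  by split=> //; exists y; [exact: (chain_right ch)|lra].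
have i0 : (0 < i)%N.
  rewrite lt0n; apply/eqP => i0; move: Cz; rewrite i0 => Cz.
  by have := sm _ _ _ (leq0n k) (chain_left ch) Cz; lra.
have [|w [Cw C'w]] := chain_meet ch (i := i.-1); first nat_lia.
rewrite prednK // in C'w.
have xw : mdist x w < 3 * e.
  rewrite ltNge; apply/negP => xw; apply: (iP i.-1); first nat_lia.
  by split; [nat_lia|exists w].
have wz := sm _ _ _ ik C'w Cz.
have yz : 6 * e <= mdist y z.
  by have := tri x w z; have := tri x z y; rewrite (metric_sym z y); lra.
exists z; split; try lra.
apply: (mem_seg _ Cz); rewrite i0 /= -ltnS prednK; last nat_lia.
rewrite ltn_neqAle ik andbT; apply/eqP => ei; move: Cz; rewrite ei => Cz.
by have := sm _ _ _ (leqnn k) (chain_right ch) Cz; lra.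
Qed.

Lemma refines_ex e d g k C l D : chain Y e x y k C -> chain Y d x y l D ->
  chain_gap x y k C g -> 2 * d <= g -> 2 * d <= e -> 10 * e <= mdist x y ->
  mid C k `<=` seg D 0 l -> exists s t, refines e k C l D s t.
Proof.
move=> chC chD [g0 gC gx gy] dg de exy CD.
have sm := chain_small chD; have tri := @metric_triangle _ X.
have e0 : 0 < e.
  by have := chain_small chC (leq0n k) (chain_left chC) (chain_left chC); rewrite mdistxx.
have d0 : 0 < d.
  by have := sm _ _ _ (leq0n l) (chain_left chD) (chain_left chD); rewrite mdistxx.
have k10 := chain_length chC exy.
have step i u v : (i < l)%N -> D i u -> D i.+1 v -> mdist u v < 2 * d.
  move=> ik Ku Kv; have [w [Kw K'w]] := chain_meet chD ik.
  have := sm i u w (ltnW ik) Ku Kw; have := sm _ w v ik K'w Kv.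
  by have := tri u w v; lra.
have [|s [/andP[_ sl] ts sP]] :=
  @ex_last (fun i => D i `&` C 0%N !=set0) 0%N l _ (leq0n _).
  by exists x; split; [exact: (chain_left chD)|exact: (chain_left chC)].
have [|t [tl tt tP]] := @ex_first (fun i => D i `&` C k !=set0) l.
  by exists y; split; [exact: (chain_right chD)|exact: (chain_right chC)].
have near_x j z : (j <= s)%N -> D j z -> mdist x z < 2 * e.
  move=> js; apply: (chain_near_left noT chD de _ _ _ (chain_left chC) _ js sl ts).
  - by lra.
  - exact: (chain_continuum chC).
  - exact: (chain_in chC).
  - by move=> a b; apply: (chain_small chC).
have near_y j z : (t <= j <= l)%N -> D j z -> mdist y z < 2 * e.
  move=> /andP[tj jl].
  apply: (chain_near_right noT chD de _ _ _ (chain_right chC) _ tj jl tt).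
  - by lra.
  - exact: (chain_continuum chC).
  - exact: (chain_in chC).
  - by move=> a b; apply: (chain_small chC).
have xyz z : mdist x y <= mdist x z + mdist y z.
  by have := tri x z y; rewrite (metric_sym z y).
have st : (s < t)%N.
  rewrite ltnNge; apply/negP => ts'; case: ts => z [Dz _].
  have := near_x s z (leqnn _) Dz; have := near_y s z _ Dz; rewrite ts' sl => /(_ isT).
  by have := xyz z; lra.
have st2 : (s.+1 < t)%N.
  rewrite ltn_neqAle st andbT; apply/eqP => st1.
  case: ts => z [Dz _]; case: tt => w [Dw _].
  have := near_x s z (leqnn _) Dz; have := near_y t w _ Dw; rewrite leqnn tl => /(_ isT).
  have := step s z w; rewrite st1 => /(_ tl Dz Dw).
  by have := xyz w; have := tri x z w; lra.
have inC : seg D s.+1 t.-1 `<=` mid C k.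
  have off j z c : (s < j < t)%N -> D j z -> C c z -> c = 0%N \/ c = k -> False.
    move=> jst Dz Cz [c0|ck]; subst c.
    - by apply: (sP j); [nat_lia|exists z].
    - by apply: (tP j); [nat_lia|exists z].
  suff : seg D s.+1 t.-1 `<=` seg C 0 k.
    move=> DC z [j /= jst Dz].
    have [|c /= ck Cz] := DC z; first by apply: mem_seg Dz; nat_lia.
    have [c0|c0] := eqVneq c 0%N; first by case: (off j z c) => //; [nat_lia|left].
    have [ek|nk] := eqVneq c k; first by case: (off j z c) => //; [nat_lia|right].
    by apply: mem_seg Cz; move: c0 nk => /eqP c0 /eqP nk; nat_lia.
  apply: (no_escape noT chC).
  - by apply: (chain_seg_continuum chD); nat_lia.
  - by apply: (chain_seg_in chD); nat_lia.
  - have [z [Mz xz yz]] := mid_far_point chC exy.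
    have [j /= jl Dz] := CD z Mz.
    exists z; split; last by apply: seg_sub Mz; nat_lia.
    have [js|sj] := leqP j s; first by have := near_x j z js Dz; lra.
    have [tj|jt] := leqP t j.
      by have := near_y j z _ Dz; rewrite tj /= => /(_ ltac:(nat_lia)); lra.
    by apply: mem_seg Dz; nat_lia.
  - apply/seteqP; split=> // z [[j /= jst Dz] Cz].
    by apply: (off j z 0%N) => //; [nat_lia|left].
  - apply/seteqP; split=> // z [[j /= jst Dz] Cz].
    by apply: (off j z k) => //; [nat_lia|right].
have inC' j : (s < j < t)%N -> D j `<=` mid C k.
  by move=> jst z Dz; apply: inC; apply: mem_seg Dz; nat_lia.
have [p [Dp Cp]] : D s.+1 `&` C 1%N !=set0.
  case: ts => z [Dz Cz].
  have [|w [Dw D'w]] := chain_meet chD (i := s); first nat_lia.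
  have [|c /= ck Cw] := inC' s.+1 _ w D'w; first nat_lia.
  exists w; split=> //; have [c1|c1] := leqP c 1.
    by move: Cw; have -> : c = 1%N by nat_lia.
  have := gC 0%N c z w ltac:(nat_lia) ltac:(nat_lia) Cz Cw.
  by have := sm _ _ _ sl Dz Dw; lra.
have [q [Dq Cq]] : D t.-1 `&` C k.-1 !=set0.
  case: tt => z [Dz Cz].
  have [|w [Dw D'w]] := chain_meet chD (i := t.-1); first nat_lia.
  rewrite prednK in D'w; last nat_lia.
  have [|c /= ck Cw] := inC' t.-1 _ w Dw; first nat_lia.
  exists w; split=> //; have [c1|c1] := leqP k.-1 c.
    by move: Cw; have -> : c = k.-1 by nat_lia.
  have := gC c k w z ltac:(nat_lia) ltac:(nat_lia) Cw Cz.
  by have := sm _ _ _ tl D'w Dz; lra.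
have cross a b i : (s < a)%N -> (a <= b)%N -> (b < t)%N -> (0 < i < k)%N ->
    seg D a b `&` seg C 0 i.-1 !=set0 -> seg D a b `&` seg C i.+1 k !=set0 ->
    seg D a b `&` C i !=set0.
  move=> sa ab bt ik; apply: (chain_separates chC) => //.
  - by case: (@chain_seg_continuum _ _ _ _ _ _ _ _ a b chD); try nat_lia.
  - move=> z [j /= jab /inC' Dz].
    by apply: (seg_sub _ _ (Dz ltac:(nat_lia))); nat_lia.
exists s, t; split=> //; first nat_lia.
move=> a b i j u v ast bst ik jk Du Cu Dv Cv ij.
rewrite ltnNge; apply/negP => ba.
pose i' := (i + 2)%N.
have [c [/= cba [w [Dw Cw]]]] : exists c, (b <= c <= a)%N /\ D c `&` C i' !=set0.
  have [||||||w [[c /= cba Dw] Cw]] := cross b a i'; try nat_lia.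
  - by exists u; split; [apply: mem_seg Du; nat_lia|apply: mem_seg Cu; nat_lia].
  - by exists v; split; [apply: mem_seg Dv; nat_lia|apply: mem_seg Cv; nat_lia].
  by exists c; split=> //; exists w.
have vw z h : D h z -> (h = b \/ h = b.+1 /\ (b < l)%N) -> ~ C i' z.
  move=> Dz hb Cz; have := gC i' j z v ltac:(nat_lia) ltac:(nat_lia) Cz Cv.
  case: hb => [hb|[hb bl]]; subst h.
  - by have := sm b z v ltac:(nat_lia) Dz Dv; lra.
  - by have := step b v z bl Dv Dz; rewrite metric_sym; lra.
have uw z h : D h z -> (h = a \/ h = a.-1 /\ (0 < a)%N) -> ~ C i' z.
  move=> Dz hb Cz; have := gC i i' u z ltac:(nat_lia) ltac:(nat_lia) Cu Cz.
  case: hb => [hb|[hb bl]]; subst h.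
  - by have := sm a u z ltac:(nat_lia) Du Dz; lra.
  - have := step a.-1 z u; rewrite prednK // => /(_ ltac:(nat_lia) Dz Du).
    by rewrite metric_sym; lra.
have cb : (b.+2 <= c)%N.
  apply: contrapT => ncb; apply: (vw w c Dw _ Cw).
  have E : c = b \/ c = b.+1 by nat_lia.
  by case: E => ->; [left|right; split=> //; nat_lia].
have ca : (c.+2 <= a)%N.
  apply: contrapT => ncb; apply: (uw w c Dw _ Cw).
  have E : c = a \/ c = a.-1 by nat_lia.
  by case: E => ->; [left|right; split=> //; nat_lia].
have notin z c1 c2 h : (c1 <= h <= c2)%N -> D h z -> ~ C i' z ->
    ~ seg D c1 c2 `<=` C i'.
  by move=> h12 Dz nCz /(_ z) Cz; apply: nCz; apply: Cz; apply: mem_seg Dz; nat_lia.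
apply: (no_three_strands noT chD (L := C i') (a1 := s.+1) (b1 := b) (a2 := b.+2)
  (b2 := a.-2) (a3 := a) (b3 := t.-1)); try nat_lia.
- by apply: (chain_continuum chC); nat_lia.
- by apply: (chain_in chC); nat_lia.
- apply: cross; try nat_lia.
  + by exists p; split; [apply: mem_seg Dp; nat_lia|apply: mem_seg Cp; nat_lia].
  + by exists v; split; [apply: mem_seg Dv; nat_lia|apply: mem_seg Cv; nat_lia].
- by exists w; split=> //; apply: mem_seg Dw; nat_lia.
- apply: cross; try nat_lia.
  + by exists u; split; [apply: mem_seg Du; nat_lia|apply: mem_seg Cu; nat_lia].
  + by exists q; split; [apply: mem_seg Dq; nat_lia|apply: mem_seg Cq; nat_lia].
- by apply: (notin v _ _ b) => //; [nat_lia|apply: (vw v b) => //; left].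
- have [|z [Dz D'z]] := chain_meet chD (i := b.+1); first nat_lia.
  apply: (notin z _ _ b.+2) => //; first nat_lia.
  by apply: (vw z b.+1) => //; right; split=> //; nat_lia.
- by apply: (notin u _ _ a) => //; [nat_lia|apply: (uw u a) => //; left].
Qed.

End Refinement.

Section ChainExistence.
Context {R : realType} {X : metricType R}.
Implicit Types (C D K : nat -> set X) (x y : X) (e d : R).

Lemma chain_weaken (Y : set X) e d x y k K : e <= d -> chain Y e x y k K ->
  chain Y d x y k K.
Proof.
move=> ed [kK dK *]; split=> // i ik; apply: lt_le_trans (dK i ik) _.
by rewrite lee_fin.
Qed.

Lemma ECCe_chain e x y : e <= 1 -> ECCe X e (x, y) ->
  exists k K, chain [set z | ECCe X 1 (x, z)] e x y k K.
Proof.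
move=> e1 [k0 [K0 wK0]].
pose weak k K := [/\ forall i, (i <= k)%N -> continuum (K i) /\ (diam (K i) < e%:E)%E,
  K 0%N x, K k y & forall i, (i < k)%N -> K i `&` K i.+1 !=set0].
have [k [_ [K [kK Kx Ky mK]] kmin]] := @ex_first (fun k => exists K, weak k K) k0
  (ex_intro _ K0 wK0).
exists k, K; split=> //.
- by move=> i /kK[].
- by move=> i /kK[].
- move=> i ik z Kz; exists i, K; split=> //= [j ji|j ji]; last by apply: mK; lia.
  have [|? /lt_le_trans de] := kK j; first lia.
  by split=> //; apply: de; rewrite lee_fin.
- move=> i j a ij jk Ki Kj.
  pose shift t := if (t <= i)%N then t else (t + (j - i.+1))%N.
  have [] := kmin (k - (j - i.+1))%N; first lia.
  exists (K \o shift); split=> /=.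
  + by move=> t tk; apply: kK; rewrite /shift; case: ifP; lia.
  + by rewrite /shift leq0n.
  + rewrite /shift; case: ifP => ti; first lia.
    by rewrite subnK //; lia.
  + move=> t tk; have [ti|ti|ti] := ltngtP t i.
    * by rewrite /shift ti (ltnW ti); apply: mK; lia.
    * rewrite /shift; case: ifP; first lia.
      by case: ifP; first lia; move=> _ _; apply: mK; lia.
    * rewrite /shift ti leqnn ltnn; exists a; split=> //.
      by rewrite (_ : (i.+1 + _)%N = j) //; lia.
- move=> i ik Ki; apply/eqP; rewrite -leqn0 leqNgt; apply/negP => i0.
  have [] := kmin (k - i)%N; first lia.
  exists (fun t => K (t + i)%N); split=> //.
  + by move=> t tk; apply: kK; lia.
  + by rewrite subnK.
  + by move=> t tk; apply: mK; lia.
- move=> i ik Ki; apply/eqP; rewrite eqn_leq ik leqNgt; apply/negP => i0.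
  have [] := kmin i; first lia.
  exists K; split=> // t tk; first by apply: kK; lia.
  by apply: mK; lia.
Qed.

End ChainExistence.

Section Family.
Context {R : realType} {X : metricType R} (Y : set X) (x y : X).
Hypothesis noT : forall T : set X, triod T -> ~ T `<=` Y.
Hypothesis chain_ex : forall e : R, 0 < e -> exists k K, chain Y e x y k K.
Implicit Types (C D K : nat -> set X) (e d : R) (P : nat -> (nat -> set X) -> Prop).

(* On a circle, fine chains may follow either of the two arcs; [P] selects one. *)
Lemma coherent_family_ex e0 : 0 < e0 -> 2 * e0 <= mdist x y -> exists P,
  (forall d, 0 < d -> exists k C, chain Y d x y k C /\ P k C) /\
  (forall k C, chain Y e0 x y k C -> P k C ->
    exists2 d : R, 0 < d &
      forall l D, chain Y d x y l D -> P l D -> mid C k `<=` seg D 0 l).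
Proof.
move=> e00 e0xy.
have [[k0 [C0 [ch0 avoid]]]|] := pselect (exists k C, chain Y e0 x y k C /\
    forall d, 0 < d -> exists l D, chain Y d x y l D /\ mid C k `&` seg D 0 l = set0).
- exists (fun l D => mid C0 k0 `&` seg D 0 l = set0); split=> // k C ch avC.
  have [g gC] := chain_gap_ex ch; have g0 : 0 < g by case: gC.
  exists (Num.min g e0); first by rewrite lt_min g0.
  move=> l D chD avD.
  have chDg : chain Y g x y l D by apply: chain_weaken chD; rewrite ge_min lexx.
  have chDe : chain Y e0 x y l D by apply: chain_weaken chD; rewrite ge_min lexx orbT.
  have [//|CD] := mid_dichotomy noT ch chDg gC (lexx g) e0xy.
  by case: (no_three_mids noT ch0 ch chDe (lexx e0) (lexx e0) (lexx e0)).
- move=> /forallNP nex; exists (fun _ _ => True); split.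
    by move=> d /chain_ex[k [K chK]]; exists k, K.
  move=> k C ch _; have [g gC] := chain_gap_ex ch; have g0 : 0 < g by case: gC.
  move: (nex k) => /forallNP/(_ C)/not_andP[//|/existsNP[d /not_implyP[d0 nD]]].
  exists (Num.min g d); first by rewrite lt_min g0.
  move=> l D chD _.
  have chDg : chain Y g x y l D by apply: chain_weaken chD; rewrite ge_min lexx.
  have chDd : chain Y d x y l D by apply: chain_weaken chD; rewrite ge_min lexx orbT.
  have [//|CD] := mid_dichotomy noT ch chDg gC (lexx g) e0xy.
  by case: nD; exists l, D.
Qed.

End Family.

(** * The limit continuum and its order *)

Section Limit.
Context {R : realType} {X : metricType R} (Y : set X) (x y : X).
Hypothesis noT : forall T : set X, triod T -> ~ T `<=` Y.
Variables (P : nat -> (nat -> set X) -> Prop) (e0 : R).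
Hypothesis e0_gt0 : 0 < e0.
Hypothesis e0_small : 10 * e0 <= mdist x y.
Implicit Types (C D K : nat -> set X) (e d : R) (Q : nat -> (nat -> set X) -> Prop).

Definition fam_chain d k C := chain Y d x y k C /\ P k C.

Hypothesis fam_ex : forall d, 0 < d -> exists k C, fam_chain d k C.

Hypothesis fam_mid : forall k C, fam_chain e0 k C ->
  exists2 d : R, 0 < d & forall l D, fam_chain d l D -> mid C k `<=` seg D 0 l.

Definition eventual Q := exists2 d : R, 0 < d & forall l D, fam_chain d l D -> Q l D.

Lemma fam_chain_weaken e d k C : e <= d -> fam_chain e k C -> fam_chain d k C.
Proof. by move=> ed [ch Pk]; split=> //; exact: chain_weaken ed ch. Qed.

Lemma eventual_and Q1 Q2 : eventual Q1 -> eventual Q2 ->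
  eventual (fun l D => Q1 l D /\ Q2 l D).
Proof.
move=> [d d0 h1] [d' d'0 h2]; exists (Num.min d d'); first by rewrite lt_min d0.
move=> l D fD; split; first by apply: h1; apply: fam_chain_weaken fD; rewrite ge_min lexx.
by apply: h2; apply: fam_chain_weaken fD; rewrite ge_min lexx orbT.
Qed.

Lemma eventual_mono Q1 Q2 : (forall l D, Q1 l D -> Q2 l D) -> eventual Q1 -> eventual Q2.
Proof. by move=> Q12 [d d0 h]; exists d => // l D /h/Q12. Qed.

Lemma eventual_ex Q : eventual Q -> exists l D, Q l D.
Proof. by move=> [d d0 h]; have [l [D /h]] := fam_ex d0; exists l, D. Qed.

Lemma eventual_fam_chain d : 0 < d -> eventual (fam_chain d).
Proof. by move=> d0; exists d. Qed.

Lemma eventual_refines e k C : e <= e0 -> fam_chain e k C ->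
  eventual (fun l D => mid C k `<=` mid D l /\ exists s t, refines x y e k C l D s t).
Proof.
move=> ee0 fC; have [chC PC] := fC.
have e_gt0 : 0 < e.
  by have := chain_small chC (leq0n k) (chain_left chC) (chain_left chC); rewrite mdistxx.
have [g gC] := chain_gap_ex chC; have [g0 _ gx gy] := gC.
have [||d [d_gt0 dg de]] := @pos_min _ (g / 2) (e / 2); rewrite ?divr_gt0 //.
apply: eventual_mono (eventual_and (eventual_fam_chain d_gt0)
  (fam_mid (fam_chain_weaken ee0 fC))) => l D [[chD _] CD].
split; last first.
  by apply: (refines_ex noT chC chD gC) => //; have := e0_small; have := e0_gt0; lra.
move=> z Cz; have [j /= jl Dz] := CD z Cz; case: (Cz) => i /= ik Ciz.
have k10 : (10 <= k)%N.
  by apply: (chain_length chC); have := e0_small; have := e0_gt0; lra.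
apply: (mem_seg (i := j)) => //; apply/andP; split.
- rewrite lt0n; apply/eqP => j0; subst j.
  have := chain_small chD (leq0n l) (chain_left chD) Dz.
  by have := gx i z ltac:(nat_lia) Ciz; lra.
- suff : j <> l by nat_lia.
  move=> jl'; subst j.
  have := chain_small chD (leqnn l) (chain_right chD) Dz.
  by have := gy i z ltac:(nat_lia) Ciz; lra.
Qed.

Definition limit_core : set X := [set z | exists k C, fam_chain e0 k C /\ mid C k z].

Definition limit_set : set X := limit_core `|` [set x] `|` [set y].

Lemma eventual_limit_core z : limit_core z -> eventual (fun l D => mid D l z).
Proof.
move=> [k [C [fC Cz]]].
by apply: eventual_mono (eventual_refines (lexx _) fC) => l D [CD _]; exact: CD.
Qed.

Lemma eventual_limit_set z : limit_set z -> eventual (fun l D => seg D 0 l z).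
Proof.
move=> [[cz|->]|->].
- apply: eventual_mono (eventual_limit_core cz) => l D; apply: seg_sub; nat_lia.
- apply: eventual_mono (eventual_fam_chain e0_gt0) => l D [ch _].
  by apply: mem_seg (chain_left ch); nat_lia.
- apply: eventual_mono (eventual_fam_chain e0_gt0) => l D [ch _].
  by apply: mem_seg (chain_right ch); nat_lia.
Qed.

Lemma limit_set_cover e k C : e <= e0 -> fam_chain e k C -> limit_set `<=`
  mid C k `|` [set z | mdist x z < 2 * e] `|` [set z | mdist y z < 2 * e].
Proof.
move=> ee0 fC; have [chC _] := fC.
have e_gt0 : 0 < e.
  by have := chain_small chC (leq0n k) (chain_left chC) (chain_left chC); rewrite mdistxx.
move=> z [[cz|->]|->]; last 2 first.
- by left; right; rewrite /= mdistxx; lra.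
- by right; rewrite /= mdistxx; lra.
have [l [D [Dz [_ [s [t [/andP[st tl] near_x near_y inC _]]]]]]] :=
  eventual_ex (eventual_and (eventual_limit_core cz) (eventual_refines ee0 fC)).
case: Dz => j /= jl Dz.
have [js|sj] := leqP j s; first by left; right; exact: near_x Dz.
have [tj|jt] := leqP t j; first by right; apply: (near_y j) => //; nat_lia.
by left; left; apply: (inC j) => //; nat_lia.
Qed.

Lemma mid_sub_limit_set k C : fam_chain e0 k C -> mid C k `<=` limit_set.
Proof. by move=> fC z Cz; left; left; exists k, C. Qed.

Lemma limit_set_compact : compact limit_set.
Proof.
apply/compact_near_coveringP => I F Q FF cover.
have at_pt p : limit_set p -> exists2 r : R, 0 < r &
    \forall i \near F, forall z, mdist p z < r -> Q i z.
  move=> /cover[[A B] /= [/nbhs_mdist[r r0 rA] FB] AB]; exists r => //.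
  by apply: filterS FB => i Bi z /rA Az; exact: (AB (z, i)).
have [|rx rx0 Fx] := at_pt x; first by left; right.
have [|ry ry0 Fy] := at_pt y; first by right.
have [||e1 [e1_gt0 erx ery]] := @pos_min _ (rx / 2) (ry / 2); rewrite ?divr_gt0 //.
have [e [e_gt0 ee0 ee1]] := pos_min e0_gt0 e1_gt0.
have [k [C fC]] := fam_ex e_gt0; have [chC _] := fC.
have k2 : (2 <= k)%N by apply: (chain_length chC); have := e0_small; have := e0_gt0; lra.
have : \forall i \near F, mid C k `<=` Q i.
  have [_ cM _] : continuum (mid C k) by apply: (chain_seg_continuum chC); nat_lia.
  move/compact_near_coveringP : cM; apply => p Cp; apply: cover.
  by apply: mid_sub_limit_set Cp; exact: fam_chain_weaken fC.
move=> Fm; near=> i => z /(limit_set_cover ee0 fC) [[Cz|/= xz]|/= yz].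
- by apply: (near Fm i) Cz.
- by apply: (near Fx i) => //; lra.
- by apply: (near Fy i) => //; lra.
Unshelve. all: by end_near. Qed.

Lemma limit_set_closure : limit_set = closure limit_core.
Proof.
apply/seteqP; split; last first.
  have /closure_id -> : closed limit_set.
    by apply: compact_closed limit_set_compact; exact: metric_hausdorff.
  by apply: closureS => z cz; left; left.
have near r : 0 < r -> exists k C, fam_chain (Num.min e0 r) k C /\ (2 <= k)%N.
  move=> r0; have e_gt0 : 0 < Num.min e0 r by rewrite lt_min e0_gt0.
  have [k [C fC]] := fam_ex e_gt0; exists k, C; split=> //.
  apply: (chain_length (proj1 fC)).
  have : Num.min e0 r <= e0 by rewrite ge_min lexx.
  by move: e0_small; lra.
have small r a b : mdist a b < Num.min e0 r -> mdist a b < r.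
  by move=> ab; apply: lt_le_trans ab _; rewrite ge_min lexx orbT.
have coreI r k C z : fam_chain (Num.min e0 r) k C -> mid C k z -> limit_core z.
  move=> fC Cz; exists k, C; split=> //.
  by apply: fam_chain_weaken fC; rewrite ge_min lexx.
move=> z [[cz|->]|->]; first exact: subset_closure.
- move=> B /nbhs_mdist[r r0 rB]; have [k [C [fC k2]]] := near r r0.
  have [chC _] := fC; have [|w [Cw C'w]] := chain_meet chC (i := 0%N); first nat_lia.
  exists w; split; first by apply: (coreI r k C w fC); apply: mem_seg C'w; nat_lia.
  by apply: rB; apply: small; exact: (chain_small chC (leq0n k) (chain_left chC) Cw).
- move=> B /nbhs_mdist[r r0 rB]; have [k [C [fC k2]]] := near r r0.
  have [chC _] := fC; have [|w [Cw C'w]] := chain_meet chC (i := k.-1); first nat_lia.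
  rewrite prednK in C'w; last nat_lia.
  exists w; split; first by apply: (coreI r k C w fC); apply: mem_seg Cw; nat_lia.
  by apply: rB; apply: small; exact: (chain_small chC (leqnn k) (chain_right chC) C'w).
Qed.

Lemma limit_set_connected : connected limit_set.
Proof.
rewrite limit_set_closure; apply: connected_closure.
have [k [C fC]] := fam_ex e0_gt0.
have len l D : fam_chain e0 l D -> (2 <= l)%N.
  move=> [ch _]; apply: (chain_length ch).
  by have := e0_small; have := e0_gt0; lra.
pose J := [set p : nat * (nat -> set X) |
  fam_chain e0 p.1 p.2 /\ mid C k `<=` mid p.2 p.1].
have -> : limit_core = \bigcup_(p in J) mid p.2 p.1.
  apply/seteqP; split=> [z cz|z [[l D] /= [fD _] Dz]]; last by exists l, D.
  have [l [D [[Dz [CD _]] fD]]] :=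
    eventual_ex (eventual_and (eventual_and (eventual_limit_core cz)
      (eventual_refines (lexx _) fC)) (eventual_fam_chain e0_gt0)).
  by exists (l, D).
apply: bigcup_connected => [|[l D] [/= fD _]].
- have k2 := len _ _ fC.
  have [[z Cz] _ _] := chain_continuum (proj1 fC) (ltnW k2 : (1 <= k)%N).
  by exists z => -[l D] /= [_ CD]; apply: CD; apply: mem_seg Cz; nat_lia.
- have l2 : (2 <= l)%N := len _ _ fD.
  have [chD _] : fam_chain e0 l D := fD.
  have [//] : continuum (mid D l) by apply: (chain_seg_continuum chD); nat_lia.
Qed.

Definition before u v := eventual (fun l D => forall i j, (i <= l)%N -> (j <= l)%N ->
  D i u -> D j v -> (i < j)%N).

Lemma before_trans u v w : limit_set v -> before u v -> before v w -> before u w.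
Proof.
move=> Iv uv vw.
apply: eventual_mono (eventual_and (eventual_limit_set Iv) (eventual_and uv vw)).
move=> l D [[h /= hl Dv] [uvD vwD]] i j il jl Du Dw.
by apply: (@ltn_trans h); [apply: uvD|apply: vwD].
Qed.

Lemma before_left v : v <> x -> before x v.
Proof.
move=> /eqP; rewrite eq_sym -mdist_gt0 => vx.
apply: eventual_mono (eventual_fam_chain vx) => l D [ch _] i j il jl Di Dj.
rewrite (chain_leftE ch il Di) lt0n; apply/eqP => j0; subst j.
by have := chain_small ch jl (chain_left ch) Dj; rewrite ltxx.
Qed.

Lemma before_right v : v <> y -> before v y.
Proof.
move=> /eqP; rewrite eq_sym -mdist_gt0 => vy.
apply: eventual_mono (eventual_fam_chain vy) => l D [ch _] i j il jl Di Dj.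
rewrite (chain_rightE ch jl Dj) ltn_neqAle il andbT; apply/eqP => j0; subst i.
by have := chain_small ch (leqnn l) (chain_right ch) Di; rewrite ltxx.
Qed.

Lemma limit_core_not_ends z : limit_core z -> z <> x /\ z <> y.
Proof.
move=> [k [C [[ch _] [i /= ik Cz]]]]; split=> ez; subst z.
  by have := chain_leftE ch (i := i); move=> /(_ ltac:(nat_lia) Cz); nat_lia.
have k2 : (2 <= k)%N by apply: (chain_length ch); have := e0_small; have := e0_gt0; lra.
by have := chain_rightE ch (i := i); move=> /(_ ltac:(nat_lia) Cz); nat_lia.
Qed.

Lemma before_limit_core u v : limit_core u -> limit_core v -> u <> v ->
  before u v \/ before v u.
Proof.
move=> cu cv /eqP; rewrite -mdist_gt0 => uv.
have [/eqP ux /eqP uy] := limit_core_not_ends cu.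
have [/eqP vx /eqP vy] := limit_core_not_ends cv.
have pos (a b : X) : a != b -> 0 < mdist b a / 2.
  by rewrite eq_sym -mdist_gt0 => ab; rewrite divr_gt0.
near (0 : R)^'+ => e.
have e_gt0 : 0 < e by near: e; exact: nbhs_right_gt.
have ee0 : e <= e0 by near: e; exact: nbhs_right_ltW.
have euv : e <= mdist u v / 5 by near: e; apply: nbhs_right_ltW; rewrite divr_gt0.
have exu : e <= mdist x u / 2 by near: e; apply: nbhs_right_ltW; exact: pos.
have eyu : e <= mdist y u / 2 by near: e; apply: nbhs_right_ltW; exact: pos.
have exv : e <= mdist x v / 2 by near: e; apply: nbhs_right_ltW; exact: pos.
have eyv : e <= mdist y v / 2 by near: e; apply: nbhs_right_ltW; exact: pos.
have [k [C [[[i /= ik Cu] [j /= jk Cv]] fC]]] :=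
  eventual_ex (eventual_and (eventual_and (eventual_limit_core cu)
    (eventual_limit_core cv)) (eventual_fam_chain e_gt0)).
have [chC _] := fC.
have key a b h h' : (h <= k)%N -> (h' <= k)%N -> C h a -> C h' b ->
    2 * e <= mdist x a -> 2 * e <= mdist y a -> 2 * e <= mdist x b ->
    2 * e <= mdist y b -> 5 * e <= mdist a b -> (h <= h')%N -> before a b.
  move=> hk hk' Ca Cb xa ya xb yb ab hh.
  have hh4 : (h + 4 <= h')%N.
    have h5 : (5 <= h' - h)%N := chain_spread chC hh hk' Ca Cb ab.
    by move: h5; clear; nat_lia.
  apply: eventual_mono (eventual_refines ee0 fC).
  move=> l D [_ [s [t [st near_x near_y _ coh]]]].
  have inside i' z : (i' <= l)%N -> D i' z -> 2 * e <= mdist x z ->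
      2 * e <= mdist y z -> (s < i' < t)%N.
    move=> il Dz xz yz; apply/andP; split; rewrite ltnNge; apply/negP => le.
    - by have := near_x i' z le Dz; lra.
    - by have := near_y i' z; rewrite le il => /(_ isT Dz); lra.
  move=> i' j' il jl Da Db.
  by apply: (coh i' j' h h' a b) => //; apply: inside; eassumption.
have [ij|ji] := leqP i j.
- left; apply: (key u v i j _ _ Cu Cv _ _ _ _ _ ij).
  1,2: by clear -ik jk; nat_lia.
  1-5: by clear -euv exu eyu exv eyv; lra.
- right; apply: (key v u j i _ _ Cv Cu _ _ _ _ _ (ltnW ji)).
  1,2: by clear -ik jk; nat_lia.
  1-5: by rewrite ?(metric_sym v u); clear -euv exu eyu exv eyv; lra.
Unshelve. all: by end_near. Qed.

Lemma before_total u v : limit_set u -> limit_set v -> u <> v ->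
  before u v \/ before v u.
Proof.
have [->|/eqP ux] := eqVneq u x.
  by move=> _ _ vx; left; apply: before_left; apply: nesym.
have [->|/eqP uy] := eqVneq u y.
  by move=> _ _ vy; right; apply: before_right; apply: nesym.
have [->|/eqP vx] := eqVneq v x; first by right; exact: before_left.
have [->|/eqP vy] := eqVneq v y; first by left; exact: before_right.
by move=> [[cu|]|] // [[cv|]|] //; exact: before_limit_core.
Qed.

Lemma before_between (r : R) : 0 < r -> exists2 h : R, 0 < h & forall u w v,
  limit_set u -> limit_set w -> limit_set v -> mdist u v < h ->
  before u w -> before w v -> mdist u w < r.
Proof.
move=> r0.
have [|e [e_gt0 ee0 er]] := @pos_min _ e0 (r / 5) e0_gt0; first by rewrite divr_gt0.
have [k [C fC]] := fam_ex e_gt0; have [chC _] := fC.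
have [g [g0 _ gx gy]] := chain_gap_ex chC.
have [|e' [e'_gt0 ee' eg']] := @pos_min _ e (g / 3) e_gt0; first by rewrite divr_gt0.
have [k' [C' fC']] := fam_ex e'_gt0; have [chC' _] := fC'.
have [g' [g'0 gC' _ _]] := chain_gap_ex chC'.
exists (Num.min e' g'); first by rewrite lt_min e'_gt0.
move=> u w v Iu Iw Iv; rewrite lt_min => /andP[uve uvg] uw wv.
have k2 : (2 <= k)%N by apply: (chain_length chC); have := e0_small; have := e0_gt0; lra.
have offx z : mdist x z < g -> ~ mid C k z.
  by move=> xz [i /= ik Cz]; have := gx i z ltac:(nat_lia) Cz; rewrite leNgt xz.
have offy z : mdist y z < g -> ~ mid C k z.
  by move=> xz [i /= ik Cz]; have := gy i z ltac:(nat_lia) Cz; rewrite leNgt xz.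
have [l [D [[[[Du Dw] Dv] [uwD wvD]] [[_ [s [t G]]] [_ [s' [t' G']]]]]]] :=
  eventual_ex (eventual_and
    (eventual_and (eventual_and (eventual_and (eventual_limit_set Iu)
        (eventual_limit_set Iw)) (eventual_limit_set Iv))
      (eventual_and uw wv))
    (eventual_and (eventual_refines ee0 fC) (eventual_refines (le_trans ee' ee0) fC'))).
case: Du => a /= al Du; case: Dw => c /= cl Dw; case: Dv => b /= bl Dv.
have ac := uwD a c al cl Du Dw; have cb := wvD c b cl bl Dw Dv.
have tri := @metric_triangle _ X; have sym := @metric_sym _ X.
have xy := e0_small.
case: G => _ nx ny inC _; case: G' => st' nx' ny' inC' coh'.
have [as'|sa'] := leqP a s'.
  have xu := nx' a u as' Du; have xv := tri x u v.
  have [bs|sb] := leqP b s.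
    have := nx a u ltac:(nat_lia) Du; have := nx c w ltac:(nat_lia) Dw.
    by have := tri u x w; rewrite (sym u x); lra.
  have [tb|bt] := leqP t b.
    have := ny b v ltac:(nat_lia) Dv; have := tri x v y; rewrite (sym v y); lra.
  by case: (offx v) => //; [lra|apply: (inC b) => //; nat_lia].
have [tb'|bt'] := leqP t' b.
  have yv := ny' b v ltac:(nat_lia) Dv; have yu := tri y v u; rewrite (sym v u) in yu.
  have [ta|at_] := leqP t a.
    have := ny a u ltac:(nat_lia) Du; have := ny c w ltac:(nat_lia) Dw.
    by have := tri u y w; rewrite (sym u y); lra.
  have [as_|sa] := leqP a s.
    by have := nx a u as_ Du; have := tri x u y; rewrite (sym u y); lra.
  by case: (offy u) => //; [lra|apply: (inC a) => //; nat_lia].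
have [i /= ik Cu] := inC' a ltac:(nat_lia) u Du.
have [j /= jk Cv] := inC' b ltac:(nat_lia) v Dv.
have [h /= hk Cw] := inC' c ltac:(nat_lia) w Dw.
have ij : (i <= j.+1)%N.
  rewrite leqNgt; apply/negP => ji.
  by have := gC' j i v u ji ltac:(nat_lia) Cv Cu; rewrite sym; lra.
have ji : (j <= i.+1)%N.
  rewrite leqNgt; apply/negP => ij'.
  by have := gC' i j u v ij' ltac:(nat_lia) Cu Cv; lra.
have hj : (h < j + 4)%N.
  rewrite ltnNge; apply/negP => jh.
  have := coh' b c j h v w ltac:(nat_lia) ltac:(nat_lia) ltac:(nat_lia) ltac:(nat_lia).
  by move=> /(_ Dv Cv Dw Cw jh); nat_lia.
have ih : (i < h + 4)%N.
  rewrite ltnNge; apply/negP => hi.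
  have := coh' c a h i w u ltac:(nat_lia) ltac:(nat_lia) ltac:(nat_lia) ltac:(nat_lia).
  by move=> /(_ Dw Cw Du Cu hi); nat_lia.
have bound n z : z < n.+1%:R * e' -> (n < 5)%N -> z < r.
  move=> zn n5; apply: lt_le_trans zn _.
  have : n.+1%:R * e' <= 5 * e' by rewrite ler_pM2r // ler_nat.
  by lra.
have [ih'|hi] := leqP i h.
  by apply: (bound _ _ (chain_hop chC' ih' ltac:(nat_lia) Cu Cw)); nat_lia.
rewrite sym; apply: (bound _ _ (chain_hop chC' (ltnW hi) ltac:(nat_lia) Cw Cu)); nat_lia.
Qed.

Lemma limit_set_net (r : R) : 0 < r ->
  exists b : nat -> X, forall z, limit_set z -> exists i, mdist z (b i) < r.
Proof.
move=> r0.
have [|e [e_gt0 ee0 er]] := @pos_min _ e0 (r / 3) e0_gt0; first by rewrite divr_gt0.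
have [k [C fC]] := fam_ex e_gt0; have [chC _] := fC.
have /choice[b bC] : forall i, exists z, (i <= k)%N -> C i z.
  move=> i; have [ik|ik] := leqP i k; last by exists x.
  by have [[z Cz] _ _] := chain_continuum chC ik; exists z.
exists b => z /(limit_set_cover ee0 fC) [[[i /= ik Cz]|/= xz]|/= yz].
- exists i; have ik' : (i <= k)%N by nat_lia.
  by have := chain_small chC ik' Cz (bC i ik'); lra.
- exists 0%N; have := chain_small chC (leq0n k) (chain_left chC) (bC _ (leq0n k)).
  by have := metric_triangle z x (b 0%N); rewrite (metric_sym z x); lra.
- exists k; have := chain_small chC (leqnn k) (chain_right chC) (bC _ (leqnn k)).
  by have := metric_triangle z y (b k); rewrite (metric_sym z y); lra.
Qed.

End Limit.

(** * Arcs from orders *)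

Section HalfSeries.
Context {R : realType}.
Implicit Types (f : nat -> R).

Definition half_sum f : R := limn (series (fun m => f m * 2^-1 ^+ m)).

Let half_lt1 : `|2^-1 : R| < 1.
Proof. by rewrite ger0_norm ?invr_ge0 // invf_lt1 // ltr1n. Qed.

Lemma geometric_half_cvg (r : R) :
  series (fun m => r * 2^-1 ^+ m) @ \oo --> r * 2.
Proof.
have -> : r * 2 = r * (1 - 2^-1)^-1 by congr (_ * _); field.
exact: cvg_geometric_series.
Qed.

Lemma half_sum_cvg f : (forall m, 0 <= f m <= 1) ->
  cvgn (series (fun m => f m * 2^-1 ^+ m)).
Proof.
move=> f01; have p m : 0 <= (2^-1 : R) ^+ m by rewrite exprn_ge0 // invr_ge0.
apply: (@series_le_cvg _ _ (fun m => 1 * 2^-1 ^+ m)).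
- by move=> m; case/andP: (f01 m) => f0 _; rewrite mulr_ge0.
- by move=> m; rewrite mul1r.
- by move=> m; case/andP: (f01 m) => _ f1; rewrite ler_wpM2r.
- by apply/cvg_ex; exists (1 * 2); exact: geometric_half_cvg.
Qed.

Lemma half_sum_le f g r : (forall m, 0 <= f m <= 1) -> (forall m, 0 <= g m <= 1) ->
  (forall m, f m <= g m + r) -> half_sum f <= half_sum g + r * 2.
Proof.
move=> f01 g01 fg; have p m : 0 <= (2^-1 : R) ^+ m by rewrite exprn_ge0 // invr_ge0.
have cf : series (fun m => f m * 2^-1 ^+ m) @ \oo --> half_sum f := half_sum_cvg f01.
have cg : (fun n => series (fun m => g m * 2^-1 ^+ m) n +
    series (fun m => r * 2^-1 ^+ m) n) @ \oo --> half_sum g + r * 2.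
  by apply: cvgD; [exact: half_sum_cvg|exact: geometric_half_cvg].
apply: (ler_cvg_to cf cg); near=> n.
rewrite /series /= -big_split /=; apply: ler_sum => m _.
by rewrite -mulrDl ler_wpM2r.
Unshelve. all: by end_near. Qed.

Lemma half_sum_lt f g k : (forall m, 0 <= f m <= 1) -> (forall m, 0 <= g m <= 1) ->
  (forall m, f m <= g m) -> f k < g k -> half_sum f < half_sum g.
Proof.
move=> f01 g01 fg fgk; have p m : 0 < (2^-1 : R) ^+ m by rewrite exprn_gt0 // invr_gt0.
pose c := (g k - f k) * 2^-1 ^+ k.
have c0 : 0 < c by rewrite mulr_gt0 // subr_gt0.
apply: (@lt_le_trans _ _ (half_sum f + c)); first by rewrite ltrDl.
have cg : series (fun m => g m * 2^-1 ^+ m) @ \oo --> half_sum g := half_sum_cvg g01.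
have cf : (fun n => series (fun m => f m * 2^-1 ^+ m) n + c) @ \oo --> half_sum f + c.
  by apply: cvgD; [exact: half_sum_cvg|exact: cvg_cst].
apply: (ler_cvg_to cf cg); near=> n; rewrite /series /= -lerBrDl -sumrB.
have kn : (k < n)%N by near: n; exists k.+1.
rewrite (bigD1_seq k) ?mem_index_iota ?iota_uniq //=.
rewrite -mulrBl lerDl; apply: sumr_ge0 => m _.
by rewrite -mulrBl mulr_ge0 ?subr_ge0 // ltW.
Unshelve. all: by end_near. Qed.

End HalfSeries.

Section ArcCriterion.
Context {R : realType} {X : metricType R} (I : set X) (a b : X).

Lemma arc_of_injection (h : X -> R) : compact I -> connected I -> I a -> I b ->
  {within I, continuous h} -> (forall u v, I u -> I v -> h u = h v -> u = v) ->
  (forall u, I u -> 0 <= h u <= 1) -> h a = 0 -> h b = 1 -> arc I.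
Proof.
move=> cI kI Ia Ib ch ih h01 ha hb.
have hI t : 0 <= t <= 1 -> exists2 z, I z & h z = t.
  move=> t01; have /connected_intervalP itv : connected (h @` I).
    exact: connected_continuous_connected.
  have [z Iz <-] : (h @` I) t.
    by apply: (itv 0 1) => //; [exists a|exists b].
  by exists z.
have /choice[f fP] : forall t, exists z, 0 <= t <= 1 -> I z /\ h z = t.
  move=> t; have [/hI[z Iz hz]|t01] := boolP (0 <= t <= 1); first by exists z.
  by exists a.
exists f, h; split; [split=> //|split| |].
- apply/subspace_continuousP => t /=; rewrite in_itv /= => t01 U.
  rewrite nbhsE; case=> O [oO Oft] OU; have [Ift hft] := fP t t01.
  have cK : compact (I `\` O).
    apply: (subclosed_compact _ cI) => [|z []//]; rewrite setDE.
    apply: closedI; last exact: open_closedC.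
    by apply: compact_closed => //; exact: metric_hausdorff.
  have chK : compact (h @` (I `\` O)).
    by apply: continuous_compact => //; apply: continuous_subspaceW ch => z [].
  have oK : open (~` (h @` (I `\` O))).
    by apply: closed_openC; apply: compact_closed chK; exact: Rhausdorff.
  rewrite /within /= nbhs_simpl /=.
  have : nbhs t (~` (h @` (I `\` O))).
    apply: open_nbhs_nbhs; split=> // -[z [Iz nOz] hz].
    by apply: nOz; rewrite (ih z (f t)) // hft.
  apply: filterS => t' nK; rewrite in_itv /= => t'01; apply: OU.
  have [Ift' hft'] := fP t' t'01.
  by apply: contrapT => nO; apply: nK; exists (f t').
- by move=> _ [t /= t01 <-]; move: t01; rewrite in_itv /= => /fP[].
- by move=> _ [z Iz <-] /=; rewrite in_itv /=; exact: h01.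
- by move=> t; rewrite ?inE /= ?in_itv /= => /fP[].
- move=> z; rewrite inE => Iz; have [If hf] := fP (h z) (h01 z Iz).
  exact: ih.
Qed.

Variable prec : X -> X -> Prop.
Hypotheses (cI : compact I) (kI : connected I) (Ia : I a) (Ib : I b).
Hypothesis prec_trans : forall u v w, I v -> prec u v -> prec v w -> prec u w.
Hypothesis prec_total : forall u v, I u -> I v -> u <> v -> prec u v \/ prec v u.
Hypothesis prec_left : forall u, u <> a -> prec a u.
Hypothesis prec_right : forall u, u <> b -> prec u b.
Hypothesis ab : a <> b.
Hypothesis prec_between : forall r : R, 0 < r -> exists2 h : R, 0 < h & forall u w v,
  I u -> I w -> I v -> mdist u v < h -> prec u w -> prec w v -> mdist u w < r.
Hypothesis net : forall r : R, 0 < r ->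
  exists c : nat -> X, forall z, I z -> exists i, mdist z (c i) < r.

Definition below z : set X := [set w | I w /\ (w = z \/ prec w z)].

Definition dist_below p z : R := inf [set mdist p w | w in below z].

Lemma has_lbound_below p z : has_lbound [set mdist p w | w in below z].
Proof. by exists 0 => _ [w _ <-]; exact: mdist_ge0. Qed.

Lemma dist_below_le p z w : below z w -> dist_below p z <= mdist p w.
Proof.
by move=> zw; apply: ge_inf; [exact: has_lbound_below|exists w].
Qed.

Lemma le_dist_below p z r : I z -> (forall w, below z w -> r <= mdist p w) ->
  r <= dist_below p z.
Proof.
move=> Iz zr; apply: lb_le_inf => [|_ [w zw <-]]; last exact: zr.
by exists (mdist p z), z => //; split=> //; left.
Qed.

Lemma dist_below_anti p u v : I u -> prec u v -> dist_below p v <= dist_below p u.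
Proof.
move=> Iu uv; apply: le_dist_below => // w [Iw wu]; apply: dist_below_le.
by split=> //; right; case: wu => [->//|wu]; exact: (prec_trans Iu).
Qed.

Lemma dist_below_continuous (r : R) : 0 < r -> exists2 h : R, 0 < h & forall p u v,
  I u -> I v -> prec u v -> mdist u v < h -> dist_below p u <= dist_below p v + r.
Proof.
move=> r0; have [h h0 hP] := prec_between r0.
have [e [e0 eh er]] := pos_min h0 r0.
exists e => // p u v Iu Iv uv uve.
rewrite -lerBlDr; apply: le_dist_below => // w [Iw wv].
have [bw|uw] : below u w \/ mdist u w < r.
  have [->|/eqP wu] := eqVneq w u; first by left; split=> //; left.
  have [uw|uw] := prec_total Iu Iw (nesym wu); last by left; split=> //; right.
  right; case: wv => [->|wv]; first by lra.
  by apply: (hP u w v) => //; lra.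
- by have := dist_below_le p bw; lra.
- have := @dist_below_le p u u (conj Iu (or_introl erefl)).
  by have := metric_triangle p w u; rewrite (metric_sym w u); lra.
Qed.

Lemma below_gap u v : I u -> I v -> u <> v -> prec u v ->
  exists2 r : R, 0 < r & forall w, below u w -> r <= mdist v w.
Proof.
move=> Iu Iv /eqP; rewrite -mdist_gt0 => uv0 uv.
have [|h h0 hP] := @prec_between (mdist u v / 2); first by rewrite divr_gt0.
have [|e [e0 eh er]] := @pos_min _ h (mdist u v / 2) h0; first by rewrite divr_gt0.
exists e => // w [Iw [->|wu]]; first by rewrite metric_sym; lra.
rewrite leNgt; apply/negP => vw.
have := hP w u v Iw Iu Iv; rewrite metric_sym => /(_ ltac:(lra) wu uv).
have := metric_triangle u w v; rewrite (metric_sym u w) (metric_sym w v); lra.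
Qed.

(* The weighted sum of the distances to the initial segments is strictly
   monotone, as in the construction of Whitney maps. *)
Lemma arc_of_order : arc I.
Proof.
have /choice[c cP] : forall n, exists c : nat -> X, forall z, I z ->
    exists i, mdist z (c i) < n.+1%:R^-1.
  by move=> n; apply: net; rewrite invr_gt0.
pose q m := if unpickle m is Some ni then c ni.1 ni.2 else a.
have qP z r : I z -> 0 < r -> exists m, mdist z (q m) < r.
  move=> Iz r0; have [n nr] : exists n, n.+1%:R^-1 < r.
    by exists (Num.truncn r^-1); rewrite invf_plt ?posrE //; exact: truncnS_gt.
  have [i zi] := cP n z Iz; exists (pickle (n, i)).
  by rewrite /q pickleK; apply: lt_trans nr.
pose t z m : R := Num.min 1 (dist_below (q m) z).
have t01 z m : I z -> 0 <= t z m <= 1.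
  move=> Iz; rewrite /t le_min ler01 ge_min lexx /= andbT.
  by apply: le_dist_below => // w _; exact: mdist_ge0.
pose g z := half_sum (t z).
have tanti u v m : I u -> prec u v -> t v m <= t u m.
  by move=> Iu uv; rewrite /t le_min !ge_min lexx /= dist_below_anti ?orbT.
have ganti u v : I u -> I v -> u <> v -> prec u v -> g v < g u.
  move=> Iu Iv uv luv; have [r r0 rP] := below_gap Iu Iv uv luv.
  have [|e [e0 er e1]] := @pos_min _ (r / 2) 1 _ ltr01; first by rewrite divr_gt0.
  have [m qm] := qP v e Iv e0.
  apply: (@half_sum_lt _ _ _ m) => [k|k|k|]; [exact: t01|exact: t01|exact: tanti|].
  have dv : dist_below (q m) v < e.
    apply: le_lt_trans (dist_below_le _ _) _; last by rewrite metric_sym; exact: qm.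
    by split=> //; left.
  have du : e <= dist_below (q m) u.
    apply: le_dist_below => // w uw; have := rP w uw.
    by have := metric_triangle v (q m) w; lra.
  rewrite /t lt_min !gt_min; apply/andP; split; apply/orP; right; lra.
have gab : g b < g a by apply: ganti => //; exact: prec_left (nesym ab).
have gcont : {within I, continuous g}.
  apply/subspace_continuousP => u Iu; apply/cvgrPdist_le => e e0.
  have [|h h0 hP] := @dist_below_continuous (e / 2); first by rewrite divr_gt0.
  rewrite near_withinE; apply/nbhs_mdist; exists h => // v uv Iv.
  have tle u' v' : I u' -> I v' -> prec u' v' -> mdist u' v' < h -> g u' <= g v' + e.
    move=> Iu' Iv' luv' uv'; rewrite (_ : e = e / 2 * 2); last by lra.
    apply: half_sum_le => m; [exact: t01|exact: t01|].
    have := hP (q m) u' v' Iu' Iv' luv' uv'; rewrite /t.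
    by case: (leP 1 (dist_below (q m) u')); case: (leP 1 (dist_below (q m) v')); lra.
  have [->|/eqP vu] := eqVneq v u; first by rewrite subrr normr0 ltW.
  have [luv|lvu] := prec_total Iu Iv (nesym vu).
  - rewrite ger0_norm ?subr_ge0 ?(ltW (ganti u v Iu Iv (nesym vu) luv)) // lerBlDl.
    exact: tle.
  - rewrite ler0_norm ?subr_le0 ?(ltW (ganti v u Iv Iu vu lvu)) // opprB lerBlDl.
    by apply: tle => //; rewrite metric_sym.
have gle u : I u -> g b <= g u <= g a.
  move=> Iu; apply/andP; split.
  - by have [->//|/eqP ub] := eqVneq u b; apply/ltW/ganti => //; exact: prec_right.
  - have [->//|/eqP ua] := eqVneq u a; apply/ltW/ganti => //; first exact: nesym.
    exact: prec_left.
apply: (@arc_of_injection (fun z => (g a - g z) / (g a - g b))) => //.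
- apply/subspace_continuousP => u Iu; apply: cvgM; last exact: cvg_cst.
  apply: cvgB; first exact: cvg_cst.
  by move/subspace_continuousP : gcont; exact.
- move=> u v Iu Iv /(divIf _); rewrite subr_eq0 gt_eqF // => /(_ isT) guv.
  apply: contrapT => uv; have [l|l] := prec_total Iu Iv uv.
  + by have := ganti u v Iu Iv uv l; lra.
  + by have := ganti v u Iv Iu (nesym uv) l; lra.
- move=> u /gle /andP[bu ua]; rewrite divr_ge0 ?subr_ge0 ?(ltW gab) //=.
  by rewrite ler_pdivrMr ?subr_gt0 // mul1r lerD2l lerN2.
- by rewrite subrr mul0r.
- by rewrite divff // subr_eq0 gt_eqF.
Qed.

End ArcCriterion.

(** * Arc connection and chain connection *)

Lemma connected_locally_constant (T : topologicalType) (A : set T) (P : T -> Prop) :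
  connected A ->
  (forall t, A t -> exists U, [/\ open U, U t &
     forall t', A t' -> U t' -> P t <-> P t']) ->
  forall s t, A s -> A t -> P s -> P t.
Proof.
move=> kA locP s t As At Ps.
suff E : A `&` P = A by move: At; rewrite -E => -[].
apply: kA; first by exists s.
- exists (\bigcup_(U in [set U | open U /\ forall t', A t' -> U t' -> P t']) U).
    by apply: bigcup_open => U [].
  apply/seteqP; split=> [u [Au Pu]|u [Au [U [_ UP] Uu]]]; last by split=> //; exact: UP.
  split=> //; have [U [oU Uu UP]] := locP u Au; exists U => //.
  by split=> // t' At' Ut'; apply/(UP t').
- exists (~` \bigcup_(U in [set U | open U /\ forall t', A t' -> U t' -> ~ P t']) U).
    by apply: open_closedC; apply: bigcup_open => U [].
  apply/seteqP; split=> [u [Au Pu]|u [Au nU]].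
    by split=> // -[U [_ UP] /(UP u Au)]; exact.
  split=> //; apply: contrapT => nPu; apply: nU.
  have [U [oU Uu UP]] := locP u Au; exists U => //.
  by split=> // t' At' Ut' Pt'; apply: nPu; apply/(UP t').
Qed.

Section ArcConnection.
Context {R : realType} {X : metricType R}.
Implicit Types (x y : X) (e : R).

Lemma ECCe_refl e x : 0 < e -> ECCe X e (x, x).
Proof.
move=> e0; exists 0%N, (fun=> [set x]); split=> //= i _; split.
- by split; [exists x|exact: compact_set1|exact: connected1].
- apply: le_lt_trans (_ : (0%:E < _)%E); last by rewrite lte_fin.
  by apply: diam_le => _ _ -> ->; rewrite mdistxx.
Qed.

Lemma ECCe_extend e x u v (C : set X) : continuum C -> (diam C < e%:E)%E ->
  C u -> C v -> ECCe X e (x, u) -> ECCe X e (x, v).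
Proof.
move=> kC dC Cu Cv [k [K [kK Kx /= Ku mK]]].
exists k.+1, (fun i => if (i <= k)%N then K i else C); split=> //=.
- by move=> i _; case: ifP => // ik; exact: kK.
- by rewrite ltnn.
- move=> i; rewrite ltnS => ik; rewrite ik; case: ifP => ik'; first exact: mK.
  by exists u; split=> //; rewrite (_ : i = k) //; nat_lia.
Qed.

Lemma arc_sub_ECCe e (A : set X) x y : 0 < e -> arc A -> A x -> A y ->
  ECCe X e (x, y).
Proof.
move=> e0 [f [g [[cf _] [fA gA] _ gK]]] Ax Ay.
have fg z : A z -> f (g z) = z by move=> Az; apply: gK; rewrite inE.
have gI z : A z -> `[0, 1]%classic (g z) by move=> Az; apply: gA; exists z.
rewrite -(fg y Ay).
apply: (@connected_locally_constant R^o `[0, 1]%classic (fun t => ECCe X e (x, f t))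
  _ _ (g x) (g y)).
- exact: segment_connected.
- move=> t t01.
  have : \forall t' \near within `[0, 1]%classic (nbhs t), mdist (f t) (f t') < e / 3.
    move/subspace_continuousP : cf => /(_ t t01).
    move=> /metricType_numDomainType.cvgrPdist_lt; apply; rewrite divr_gt0 //.
  rewrite near_withinE => /nbhs_ballP[d /= d0 dP].
  exists (ball t (d / 2)); split.
  + by apply: ball_open; rewrite divr_gt0.
  + by apply: ballxx; rewrite divr_gt0.
  move=> t' t'01 tt'.
  pose J := `[Num.min t t', Num.max t t']%classic.
  have J01 : J `<=` `[0, 1]%classic.
    move: t01 t'01; rewrite /= !in_itv /= => /andP[t0 t1] /andP[t'0 t'1].
    move=> s; rewrite /J /= !in_itv /= ge_min le_max => /andP[/orP[] s0 /orP[] s1].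
    1-4: by apply/andP; split; lra.
  have Jd s : J s -> mdist (f t) (f s) < e / 3.
    move=> Js; apply: dP; last exact: J01.
    move: tt' Js; rewrite /J /= !in_itv /= ge_min le_max /ball /= !ltr_norml.
    move=> /andP[tt1 tt2] /andP[/orP[] s0 /orP[] s1].
    1-4: by apply/andP; split; lra.
  have cfJ : {within J, continuous f} by exact: continuous_subspaceW cf.
  have kJ : continuum (f @` J).
    split.
    - by exists (f t), t => //; rewrite /J /= in_itv /= ge_min le_max lexx.
    - by apply: continuous_compact => //; exact: segment_compact.
    - by apply: connected_continuous_connected => //; exact: segment_connected.
  have dJ : (diam (f @` J) < e%:E)%E.
    apply: le_lt_trans (_ : ((e * (2 / 3))%:E < _)%E); last by rewrite lte_fin; lra.
    apply: diam_le => _ _ [s Js <-] [s' Js' <-].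
    have := metric_triangle (f s) (f t) (f s'); have := Jd _ Js; have := Jd _ Js'.
    by rewrite (metric_sym (f s) (f t)); lra.
  have Jt : (f @` J) (f t) by exists t => //; rewrite /J /= in_itv /= ge_min le_max lexx.
  have Jt' : (f @` J) (f t').
    by exists t' => //; rewrite /J /= in_itv /= ge_min le_max lexx !orbT.
  by split; apply: ECCe_extend kJ dJ _ _.
- exact: gI.
- exact: gI.
- by rewrite fg //; exact: ECCe_refl.
Qed.

Lemma EA_sub_ECC : EA X `<=` ECC X.
Proof.
move=> [x y] [/= ->|[A [aA Ax Ay]]] e /= e0; first exact: ECCe_refl.
exact: arc_sub_ECCe e0 aA Ax Ay.
Qed.

Lemma ECC_arc x y : x <> y -> (forall e, 0 < e -> ECCe X e (x, y)) ->
  (forall T : set X, triod T -> ~ T `<=` [set z | ECCe X 1 (x, z)]) ->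
  exists A, [/\ arc A, A x & A y].
Proof.
move=> xy xyE noT; set Y := [set z | _] in noT.
have chain_ex e : 0 < e -> exists k K, chain Y e x y k K.
  move=> e0; have [d [d0 de d1]] := pos_min e0 (@ltr01 R).
  have [k [K ch]] := ECCe_chain d1 (xyE d d0).
  by exists k, K; exact: chain_weaken ch.
have d0 : 0 < mdist x y by rewrite mdist_gt0; apply/eqP.
pose e0 := mdist x y / 10.
have e0_gt0 : 0 < e0 by rewrite divr_gt0.
have [||P [Pex Pmid]] := @coherent_family_ex _ _ _ _ _ noT chain_ex e0 => //.
  by rewrite /e0; lra.
have e0_small : 10 * e0 <= mdist x y by rewrite /e0; lra.
have fam_mid k C : fam_chain Y x y P e0 k C -> exists2 d : R, 0 < d &
    forall l D, fam_chain Y x y P d l D -> seg C 1 k.-1 `<=` seg D 0 l.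
  by move=> [ch /(Pmid k C ch)[d dp dP]]; exists d => // l D []; exact: dP.
exists (limit_set Y x y P e0); split; [|by left; right|by right].
apply: (@arc_of_order _ _ _ x y (before Y x y P)) => //.
- exact: (limit_set_compact noT e0_gt0 e0_small).
- exact: (limit_set_connected noT e0_gt0 e0_small).
- by left; right.
- by right.
- by move=> u v w; exact: (before_trans noT e0_gt0 e0_small).
- by move=> u v; exact: (before_total noT e0_gt0 e0_small).
- by move=> u; exact: before_left.
- by move=> u; exact: before_right.
- by move=> r; exact: (before_between noT e0_gt0 e0_small).
- by move=> r; exact: (limit_set_net noT e0_gt0 e0_small).
Qed.

End ArcConnection.

Theorem lemma43 (R : realType) (X : metricType R)
  (notriod : forall n : nat, (1 <= n)%N -> forall x : X,
     ~ exists K : set X, triod K /\ K `<=` [set y | ECCe X (1 / n%:R) (x, y)]) :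
  ECC X = EA X.
Proof.
apply/seteqP; split; last exact: EA_sub_ECC.
move=> [x y] xy; have [<-|/eqP nxy] := eqVneq x y; first by left.
right; apply: ECC_arc => // T tT TY.
by apply: (notriod 1%N isT x); exists T; rewrite divr1.
Qed.
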